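(* Fix $\alpha\in(0,1)$, let $r_\star\in(0,1)$ and $\mu\in[1/2,1]$ with $2\mu+\alpha\notin\mathbb{Z}$. Then the constant function $r_\star$ (an equilibrium of $r_t=G(r)$) is unstable in the topology of $h^{2\mu+\alpha}(\mathbb{T})$ for initial values in $h^{2\mu+\alpha}(\mathbb{T})$; that is, it is not true that for every $\varepsilon>0$ there exists $\delta>0$ such that for every $r_0\in h^{2\mu+\alpha}(\mathbb{T})$ with $\|r_0-r_\star\|_{h^{2\mu+\alpha}}<\delta$ the solution $r(\cdot,r_0)$ of $r_t=G(r)$, $r(0)=r_0$, exists globally in $C^1_{1-\mu}(\mathbb{R}_+,h^\alpha(\mathbb{T}))\cap C_{1-\mu}(\mathbb{R}_+,h^{2+\alpha}(\mathbb{T}))$ and satisfies $\|r(t,r_0)-r_\star\|_{h^{2\mu+\alpha}}<\varepsilon$ for all $t\ge0$.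
   Context: $\mathbb{T}=[-\pi,\pi]$ with endpoints identified; $h^{k+\alpha}(\mathbb{T})$ is the closure of $C^\infty(\mathbb{T})$ in $C^{k+\alpha}(\mathbb{T})$, and $h^\sigma$ for non-integer $\sigma>0$ accordingly. For a positive function $r$ on $\mathbb{T}$: $S(r)=\int_{\mathbb{T}}r\sqrt{1+r_x^2}dx$, $\mathcal{H}(r)=\frac{1}{r\sqrt{1+r_x^2}}-\frac{r_{xx}}{(1+r_x^2)^{3/2}}$, $h(r)=S(r)^{-1}\int_{\mathbb{T}}\mathcal{H}(r)r\sqrt{1+r_x^2}dx$, $G(r)=\sqrt{1+r_x^2}[h(r)-\mathcal{H}(r)]$. For $\mu\in(0,1)$, $C_{1-\mu}(\mathbb{R}_+,E)$ is the set of $u\in C((0,\infty),E)$ such that on each $(0,T]$, $t^{1-\mu}u(t)$ is bounded and uniformly continuous with $t^{1-\mu}\|u(t)\|_E\to0$ as $t\to0^+$; $C^1_{1-\mu}(\mathbb{R}_+,E)=\{u\in C^1((0,\infty),E):u,\dot u\in C_{1-\mu}\}$; for $\mu=1$ these are $C(\mathbb{R}_+,E)$, $C^1(\mathbb{R}_+,E)$. *)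

(* Defs.v *)
From Stdlib Require Import Reals.
From Coquelicot Require Import Coquelicot.
Open Scope R_scope.

(** Functions on the torus T = [-pi,pi] (endpoints identified) are
    represented as 2*pi-periodic functions R -> R. *)
Definition periodic (f : R -> R) : Prop := forall x, f (x + 2 * PI) = f x.

Definition smooth_per (f : R -> R) : Prop :=
  periodic f /\ forall (n : nat) (x : R), ex_derive_n f n x.

Definition sup_deriv (f : R -> R) (j : nat) : Rbar :=
  Lub_Rbar (fun v => exists x, v = Rabs (Derive_n f j x)).

Fixpoint sum_sup_deriv (f : R -> R) (k : nat) : Rbar :=
  match k with
  | O => sup_deriv f O
  | S k' => Rbar_plus (sum_sup_deriv f k') (sup_deriv f k)
  end.

Definition holder_semi (f : R -> R) (k : nat) (beta : R) : Rbar :=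
  Lub_Rbar (fun v => exists x y, x <> y /\
     v = Rabs (Derive_n f k x - Derive_n f k y) / Rpower (Rabs (x - y)) beta).

Definition holder_norm_kb (k : nat) (beta : R) (f : R -> R) : Rbar :=
  Rbar_plus (sum_sup_deriv f k) (holder_semi f k beta).

Definition hk (sigma : R) : nat := Z.to_nat (Int_part sigma).
Definition hb (sigma : R) : R := sigma - IZR (Int_part sigma).

(** ||f||_{C^sigma} for non-integer sigma > 0 *)
Definition hnorm (sigma : R) (f : R -> R) : Rbar :=
  holder_norm_kb (hk sigma) (hb sigma) f.

Definition in_C (sigma : R) (f : R -> R) : Prop :=
  periodic f /\
  (forall j x, (j <= hk sigma)%nat -> ex_derive_n f j x) /\
  is_finite (hnorm sigma f).

Definition in_h (sigma : R) (f : R -> R) : Prop :=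
  in_C sigma f /\
  forall eps, 0 < eps -> exists phi, smooth_per phi /\
     Rbar_lt (hnorm sigma (fun x => f x - phi x)) (Finite eps).

Definition Sarea (r : R -> R) : R :=
  RInt (fun x => r x * sqrt (1 + (Derive r x) ^ 2)) (- PI) PI.

Definition Hcurv (r : R -> R) (x : R) : R :=
  / (r x * sqrt (1 + (Derive r x) ^ 2))
  - Derive_n r 2 x / ((1 + (Derive r x) ^ 2) * sqrt (1 + (Derive r x) ^ 2)).

Definition hmean (r : R -> R) : R :=
  / Sarea r * RInt (fun x => Hcurv r x * r x * sqrt (1 + (Derive r x) ^ 2)) (- PI) PI.

Definition Gop (r : R -> R) (x : R) : R :=
  sqrt (1 + (Derive r x) ^ 2) * (hmean r - Hcurv r x).

Definition diff_fun (f g : R -> R) : R -> R := fun x => f x - g x.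

Definition cont_on (J : R -> Prop) (sigma : R) (u : R -> R -> R) : Prop :=
  forall t, J t -> in_h sigma (u t) /\
    forall eps, 0 < eps -> exists eta, 0 < eta /\
      forall s, J s -> Rabs (s - t) < eta ->
        Rbar_lt (hnorm sigma (diff_fun (u s) (u t))) (Finite eps).

Definition pos_half (t : R) : Prop := 0 < t.
Definition nneg_half (t : R) : Prop := 0 <= t.

Definition Cw (mu sigma : R) (u : R -> R -> R) : Prop :=
  (mu < 1 /\
   cont_on pos_half sigma u /\
   (forall T, 0 < T ->
      (exists M, forall t, 0 < t <= T ->
          Rbar_le (hnorm sigma (fun x => Rpower t (1 - mu) * u t x)) (Finite M)) /\
      (forall eps, 0 < eps -> exists eta, 0 < eta /\
          forall s t, 0 < s <= T -> 0 < t <= T -> Rabs (s - t) < eta ->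
            Rbar_lt (hnorm sigma (fun x => Rpower s (1 - mu) * u s x
                                          - Rpower t (1 - mu) * u t x))
                    (Finite eps))) /\
   (forall eps, 0 < eps -> exists eta, 0 < eta /\
      forall t, 0 < t < eta ->
        Rbar_lt (hnorm sigma (fun x => Rpower t (1 - mu) * u t x)) (Finite eps)))
  \/
  (mu = 1 /\ cont_on nneg_half sigma u).

Definition has_deriv_on (J : R -> Prop) (sigma : R) (u u' : R -> R -> R) : Prop :=
  forall t, J t -> forall eps, 0 < eps -> exists eta, 0 < eta /\
    forall h, h <> 0 -> Rabs h < eta -> J (t + h) ->
      Rbar_lt (hnorm sigma (fun x => (u (t + h) x - u t x) / h - u' t x))
              (Finite eps).

Definition C1w_with (mu sigma : R) (u u' : R -> R -> R) : Prop :=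
  has_deriv_on (if Rlt_dec mu 1 then pos_half else nneg_half) sigma u u' /\
  Cw mu sigma u /\ Cw mu sigma u'.

Definition global_solution (mu alpha : R) (r0 : R -> R) (r : R -> R -> R) : Prop :=
  r 0 = r0 /\
  (forall eps, 0 < eps -> exists eta, 0 < eta /\
     forall t, 0 < t < eta ->
       Rbar_lt (hnorm alpha (diff_fun (r t) r0)) (Finite eps)) /\
  Cw mu (2 + alpha) r /\
  (forall t x, 0 < t -> 0 < r t x) /\
  exists r', C1w_with mu alpha r r' /\
    forall t x, 0 < t -> r' t x = Gop (r t) x.

(* Main.v *)
Require Import Defs.
From Stdlib Require Import Reals Lra Lia Psatz.
From Coquelicot Require Import Coquelicot.
Open Scope R_scope.

(** Write [v = r - rstar], let [p] be the projection of [v] on the span of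
    [cos x] and [sin x], and consider [cone v = 2 |p|^2 - |v|^2] in [L^2].  Since
    [r_xx / (1 + r_x^2)] is the derivative of [atan r_x], testing the equation
    with [2 p - v] and integrating by parts involves [r] and [r_x] only, so along
    a solution that stays [C^1]-close to [rstar] the time derivative of [cone v]
    is that of the linearised flow up to a small multiple of the squared
    [H^1]-norm of [v].  The first mode grows at the rate
    [1 / rstar^2 - 1 > 0], strictly faster than all others: the modes of
    frequency at least [2] obey a Wirtinger inequality with a constant greater
    than [1], and the nonlocal term cancels the growth of the constant mode.
    Hence [(cone v)' >= 2 k cone v] with [k > 0], which contradicts the boundedness
    of [cone v] when the solution starts at [rstar + eta cos x]. *)

(** * Integrals of continuous functions *)

(** At [mu = 1/2] the norm controls little more than one derivative, so [r_xx] is not small and the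
    equation cannot be linearised in a norm that sees it. This dictates an [L^2] functional whose
    derivative, after one integration by parts, needs only [C^1]-smallness. Splitting the spectrum
    at zero would not suit it: frequency [n >= 1] has the linear rate [1 / rstar^2 - n^2], so for
    [rstar < 1/2] several frequencies grow. The cone compares the first mode with all the rest, and
    for this only the order of the rates matters. The dissipation of the higher modes enters the
    derivative of the cone with a positive sign, because these modes carry a minus sign in it; that
    term absorbs the errors quadratic in [v_x]. Stability itself supplies the global solution that
    is refuted. *)

Definition cont (f : R -> R) : Prop := forall x, continuous f x.

Lemma cont_plus f g : cont f -> cont g -> cont (fun x => f x + g x).
Proof. intros Hf Hg x. now apply (continuous_plus f g). Qed.

Lemma cont_opp f : cont f -> cont (fun x => - f x).
Proof. intros Hf x. now apply (continuous_opp f). Qed.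

Lemma cont_minus f g : cont f -> cont g -> cont (fun x => f x - g x).
Proof. intros Hf Hg. now apply cont_plus; [|apply cont_opp]. Qed.

Lemma cont_mult f g : cont f -> cont g -> cont (fun x => f x * g x).
Proof. intros Hf Hg x. now apply (continuous_mult f g). Qed.

Lemma cont_const c : cont (fun _ => c).
Proof. intros x. apply continuous_const. Qed.

Lemma cont_pow f n : cont f -> cont (fun x => f x ^ n).
Proof.
  intros Hf. induction n as [|n IH]; simpl.
  - apply cont_const.
  - now apply cont_mult.
Qed.

Lemma cont_inv f : cont f -> (forall x, f x <> 0) -> cont (fun x => / f x).
Proof. intros Hf Hn x. now apply continuous_Rinv_comp. Qed.

Lemma cont_div f g :
  cont f -> cont g -> (forall x, g x <> 0) -> cont (fun x => f x / g x).
Proof. intros Hf Hg Hn. now apply cont_mult; [|apply cont_inv]. Qed.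

Lemma cont_derive (f f' : R -> R) : (forall x, is_derive f x (f' x)) -> cont f.
Proof. intros H x. apply (ex_derive_continuous (V := R_NormedModule)). now exists (f' x). Qed.

Lemma is_derive_minus_const (f : R -> R) c x l :
  is_derive f x l -> is_derive (fun y => f y - c) x l.
Proof.
  intros H. replace l with (minus l 0) by (unfold minus, plus, opp; simpl; ring).
  apply (is_derive_minus f (fun _ => c)); [exact H|].
  apply (is_derive_const (V := R_NormedModule)).
Qed.

Lemma cont_cos : cont cos.
Proof. intros x. apply continuous_cos. Qed.

Lemma cont_sin : cont sin.
Proof. intros x. apply continuous_sin. Qed.

Lemma cont_atan f : cont f -> cont (fun x => atan (f x)).
Proof. intros Hf x. now apply continuous_atan_comp. Qed.

Lemma cont_sqrt f : cont f -> cont (fun x => sqrt (f x)).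
Proof. intros Hf x. now apply continuous_sqrt_comp. Qed.

(* Syntactic matching keeps unification from unfolding the real operations. *)
Ltac cont_tac :=
  lazymatch goal with
  | |- cont (fun _ => ?c) => apply (cont_const c)
  | |- cont (fun x => @?f x + @?g x) => apply (cont_plus f g); cont_tac
  | |- cont (fun x => @?f x - @?g x) => apply (cont_minus f g); cont_tac
  | |- cont (fun x => @?f x * @?g x) => apply (cont_mult f g); cont_tac
  | |- cont (fun x => - @?f x) => apply (cont_opp f); cont_tac
  | |- cont (fun x => (@?f x) ^ ?n) => apply (cont_pow f n); cont_tac
  | |- cont (fun x => atan (@?f x)) => apply (cont_atan f); cont_tac
  | |- cont (fun x => sqrt (@?f x)) => apply (cont_sqrt f); cont_tac
  | |- cont (fun x => cos x) => apply cont_cos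
  | |- cont (fun x => sin x) => apply cont_sin
  | |- cont cos => apply cont_cos
  | |- cont sin => apply cont_sin
  | H : cont ?f |- cont ?f => exact H
  | H : cont ?f |- cont (fun x => ?f x) => exact H
  | |- _ => idtac
  end.

Lemma cont_ex_RInt f a b : cont f -> ex_RInt f a b.
Proof. intros Hf. apply (ex_RInt_continuous (V := R_CompleteNormedModule)). auto. Qed.

(* [RInt] with its value coerced to [R], so that [ring] and [lra] apply. *)
Definition rint (f : R -> R) (a b : R) : R := RInt f a b.

Lemma rint_ext f g a b : (forall x, f x = g x) -> rint f a b = rint g a b.
Proof. intros H. apply RInt_ext. auto. Qed.

Lemma rint_plus f g a b : cont f -> cont g ->
  rint (fun x => f x + g x) a b = rint f a b + rint g a b.
Proof.
  intros. apply (RInt_plus (V := R_CompleteNormedModule)); now apply cont_ex_RInt.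
Qed.

Lemma rint_minus f g a b : cont f -> cont g ->
  rint (fun x => f x - g x) a b = rint f a b - rint g a b.
Proof.
  intros. apply (RInt_minus (V := R_CompleteNormedModule)); now apply cont_ex_RInt.
Qed.

Lemma rint_scal f k a b : cont f ->
  rint (fun x => k * f x) a b = k * rint f a b.
Proof.
  intros. apply (RInt_scal (V := R_CompleteNormedModule)); now apply cont_ex_RInt.
Qed.

Lemma rint_const (c a b : R) : rint (fun _ => c) a b = c * (b - a).
Proof. unfold rint. rewrite RInt_const. unfold scal; simpl; unfold mult; simpl. ring. Qed.

Lemma rint_le f g a b : a <= b -> cont f -> cont g ->
  (forall x, f x <= g x) -> rint f a b <= rint g a b.
Proof. intros. apply RInt_le; auto; now apply cont_ex_RInt. Qed.

Lemma rint_Chasles f a b c : cont f ->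
  rint f a b + rint f b c = rint f a c.
Proof.
  intros. apply (RInt_Chasles (V := R_CompleteNormedModule)); now apply cont_ex_RInt.
Qed.

Lemma rint_of_derive (f f' : R -> R) a b : (forall x, is_derive f x (f' x)) -> cont f' ->
  rint f' a b = f b - f a.
Proof.
  intros Hf Hc. apply is_RInt_unique.
  apply (is_RInt_derive (V := R_CompleteNormedModule) f f'); auto.
Qed.

(** * Integration over one period *)

Notation tint f := (rint f (- PI) PI).

Lemma mPI_le_PI : - PI <= PI.
Proof. generalize PI_RGT_0; lra. Qed.

Lemma tint_le f g : cont f -> cont g -> (forall x, f x <= g x) -> tint f <= tint g.
Proof. apply rint_le, mPI_le_PI. Qed.

Lemma tint_nonneg f : cont f -> (forall x, 0 <= f x) -> 0 <= tint f.
Proof.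
  intros Cf H. rewrite <- (Rmult_0_l (PI - - PI)), <- rint_const.
  apply tint_le; auto. cont_tac.
Qed.

Lemma tint_abs_le f c : cont f -> (forall x, Rabs (f x) <= c) ->
  Rabs (tint f) <= 2 * PI * c.
Proof.
  intros Hf Hb. replace (2 * PI * c) with ((PI - - PI) * c) by ring.
  apply abs_RInt_le_const; [apply mPI_le_PI | now apply cont_ex_RInt | auto].
Qed.

Lemma tint_lin4 f1 f2 f3 f4 k1 k2 k3 k4 : cont f1 -> cont f2 -> cont f3 -> cont f4 ->
  tint (fun x => k1 * f1 x + k2 * f2 x + k3 * f3 x + k4 * f4 x)
  = k1 * tint f1 + k2 * tint f2 + k3 * tint f3 + k4 * tint f4.
Proof.
  intros.
  rewrite 3!rint_plus by cont_tac. now rewrite !rint_scal.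
Qed.

Lemma periodic_ends f : periodic f -> f (- PI) = f PI.
Proof. intros Hp. rewrite <- (Hp (- PI)). f_equal. ring. Qed.

Lemma tint_by_parts (f f' g g' : R -> R) :
  (forall x, is_derive f x (f' x)) -> (forall x, is_derive g x (g' x)) ->
  cont f' -> cont g' -> periodic f -> periodic g ->
  tint (fun x => f' x * g x) = - tint (fun x => f x * g' x).
Proof.
  intros Hf Hg Cf Cg Pf Pg.
  assert (Cf0 := cont_derive _ _ Hf). assert (Cg0 := cont_derive _ _ Hg).
  assert (H : tint (fun x => f' x * g x + f x * g' x) = 0).
  { rewrite (rint_of_derive (fun x => f x * g x)).
    - rewrite (periodic_ends f), (periodic_ends g) by auto. ring.
    - intros x. specialize (Hf x). specialize (Hg x).
      evar_last. { apply (is_derive_mult f g); eauto. intros; apply Rmult_comm. }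
      unfold plus, mult; simpl. ring.
    - cont_tac. }
  rewrite rint_plus in H by cont_tac. lra.
Qed.

Lemma periodic_rint_shift f c : cont f -> periodic f ->
  rint f c (c + 2 * PI) = tint f.
Proof.
  intros Cf Pf.
  assert (H : rint f PI (c + 2 * PI) = rint f (- PI) c).
  { assert (E := RInt_comp_lin (V := R_CompleteNormedModule) f 1 (2 * PI) (- PI) c).
    replace (1 * - PI + 2 * PI) with PI in E by ring.
    replace (1 * c + 2 * PI) with (c + 2 * PI) in E by ring.
    unfold rint. rewrite <- E by (now apply cont_ex_RInt).
    apply RInt_ext. intros x _. unfold scal; simpl; unfold mult; simpl.
    rewrite Rmult_1_l. replace (1 * x) with x by ring. apply Pf. }
  rewrite <- (rint_Chasles f c (- PI) (c + 2 * PI)) by auto.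
  rewrite <- (rint_Chasles f (- PI) PI (c + 2 * PI)) by auto.
  rewrite H.
  assert (E := rint_Chasles f c (- PI) c Cf).
  assert (E0 : rint f c c = 0) by apply (RInt_point (V := R_CompleteNormedModule)). lra.
Qed.

(** * Trigonometric integrals over one period *)

Lemma is_derive_mcos x : is_derive (fun y => - cos y) x (sin x).
Proof. auto_derive; auto; ring. Qed.

Lemma tint_cos : tint cos = 0.
Proof.
  rewrite (rint_of_derive sin).
  - rewrite sin_neg, sin_PI. ring.
  - intros x. auto_derive; auto; ring.
  - cont_tac.
Qed.

Lemma tint_sin : tint sin = 0.
Proof.
  rewrite (rint_of_derive _ _ _ _ is_derive_mcos) by cont_tac.
  rewrite cos_neg. ring.
Qed.

Lemma tint_cos_sin : tint (fun x => cos x * sin x) = 0.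
Proof.
  rewrite (rint_of_derive (fun x => sin x ^ 2 / 2)).
  - rewrite sin_neg, sin_PI. field.
  - intros x. auto_derive; auto; field.
  - cont_tac.
Qed.

Lemma tint_cos2 : tint (fun x => cos x * cos x) = PI.
Proof.
  rewrite (rint_of_derive (fun x => (x + sin x * cos x) / 2)).
  - rewrite sin_neg, sin_PI. field.
  - intros x. auto_derive; auto.
    assert (H := sin2_cos2 x). unfold Rsqr in H. lra.
  - cont_tac.
Qed.

Lemma tint_sin2 : tint (fun x => sin x * sin x) = PI.
Proof.
  rewrite (rint_of_derive (fun x => (x - sin x * cos x) / 2)).
  - rewrite sin_neg, sin_PI. field.
  - intros x. auto_derive; auto.
    assert (H := sin2_cos2 x). unfold Rsqr in H. lra.
  - cont_tac.
Qed.

Lemma periodic_cos : periodic cos.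
Proof. intros x. rewrite cos_plus, cos_2PI, sin_2PI. ring. Qed.

Lemma periodic_sin : periodic sin.
Proof. intros x. rewrite sin_plus, cos_2PI, sin_2PI. ring. Qed.

Lemma periodic_derive (f f' : R -> R) : periodic f -> (forall x, is_derive f x (f' x)) -> periodic f'.
Proof.
  intros Pf Hf x.
  assert (H : is_derive f x (f' (x + 2 * PI))).
  { apply (is_derive_ext (fun y => f (y + 2 * PI))); [intros; apply Pf|].
    evar_last. { apply (is_derive_comp f (fun y => y + 2 * PI)); [apply Hf|].
      auto_derive; auto. }
    unfold scal; simpl; unfold mult; simpl. ring. }
  now rewrite <- (is_derive_unique _ _ _ H), (is_derive_unique _ _ _ (Hf x)).
Qed.

(** * A Wirtinger inequality with a spectral gap *)

(* [g' ^ 2 - (3/2)^2 g ^ 2 = (g' + (3/2) g T)^2 - ((3/2) g^2 T)'] with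
   [T = tan (3/2 (x - m))], which is smooth on the closed interval. *)
Lemma dirichlet_poincare (g g' : R -> R) a :
  (forall x, is_derive g x (g' x)) -> cont g' ->
  g a = 0 -> g (a + PI / 2) = 0 ->
  9 / 4 * rint (fun x => g x ^ 2) a (a + PI / 2) <= rint (fun x => g' x ^ 2) a (a + PI / 2).
Proof.
  intros Hg Cg' Ha Hb. assert (Cg := cont_derive _ _ Hg).
  assert (HP := PI_RGT_0).
  set (T := fun x => tan (3 / 2 * (x - (a + PI / 4)))).
  set (W' := fun x => 3 * g x * g' x * T x + 9 / 4 * g x ^ 2 * (T x ^ 2 + 1)).
  (* The angle stays within [3 PI / 8] of zero. The sharp factor [2] would put the poles of the
     tangent at both ends of the interval. *)
  assert (Hcos : forall x, a <= x <= a + PI / 2 -> cos (3 / 2 * (x - (a + PI / 4))) <> 0).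
  { intros x Hx. apply Rgt_not_eq. apply cos_gt_0; lra. }
  assert (HT : forall x, a <= x <= a + PI / 2 -> is_derive T x (3 / 2 * (T x ^ 2 + 1))).
  { intros x Hx. unfold T. evar_last.
    { apply (is_derive_comp tan (fun x => 3 / 2 * (x - (a + PI / 4)))).
      - apply is_derive_tan. now apply Hcos.
      - auto_derive; auto. }
    unfold scal; simpl; unfold mult; simpl. ring. }
  assert (CT : forall x, a <= x <= a + PI / 2 -> continuous T x).
  { intros x Hx. apply (ex_derive_continuous (V := R_NormedModule)). eexists. now apply HT. }
  assert (CW : forall x, a <= x <= a + PI / 2 -> continuous W' x).
  { intros x Hx. unfold W'. specialize (CT x Hx).
    apply (continuous_plus (fun x => 3 * g x * g' x * T x)).
    - apply (continuous_mult (fun x => 3 * g x * g' x) T); auto.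
      apply (cont_mult (fun x => 3 * g x)); cont_tac.
    - apply (continuous_mult (fun x => 9 / 4 * g x ^ 2)).
      + apply (cont_mult (fun x => 9 / 4)); cont_tac.
      + apply (continuous_plus (fun x => T x ^ 2)); [|apply continuous_const].
        simpl. apply (continuous_mult T); auto.
        apply (continuous_mult T); auto. apply continuous_const. }
  assert (HW : is_RInt W' a (a + PI / 2) 0).
  { evar_last.
    { apply (is_RInt_derive (V := R_CompleteNormedModule) (fun x => 3 / 2 * g x ^ 2 * T x) W').
      - rewrite Rmin_left, Rmax_right by lra. intros x Hx.
        specialize (HT x Hx). specialize (Hg x). unfold W'.
        evar_last.
        { apply (is_derive_mult (fun x => 3 / 2 * g x ^ 2) T); [|exact HT|intros; apply Rmult_comm].
          apply (is_derive_scal (fun x => g x ^ 2)).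
          apply (is_derive_pow g). exact Hg. }
        unfold plus, mult; simpl. field.
      - rewrite Rmin_left, Rmax_right by lra. exact CW. }
    rewrite Ha, Hb. unfold minus, plus, opp; simpl. ring. }
  assert (C1 : ex_RInt (fun x => g' x ^ 2 - 9 / 4 * g x ^ 2) a (a + PI / 2)).
  { apply cont_ex_RInt. cont_tac. }
  assert (H : 0 <= rint (fun x => g' x ^ 2 - 9 / 4 * g x ^ 2 + W' x) a (a + PI / 2)).
  { apply RInt_ge_0; [lra| |].
    - apply (ex_RInt_plus (V := R_CompleteNormedModule) (fun x => g' x ^ 2 - 9 / 4 * g x ^ 2)); auto.
      now exists 0.
    - intros x Hx. unfold W'.
      replace (_ + _) with ((g' x + 3 / 2 * g x * T x) ^ 2) by field.
      apply pow2_ge_0. }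
  assert (E : rint (fun x => g' x ^ 2 - 9 / 4 * g x ^ 2 + W' x) a (a + PI / 2)
    = rint (fun x => g' x ^ 2 - 9 / 4 * g x ^ 2) a (a + PI / 2) + rint W' a (a + PI / 2)).
  { apply (RInt_plus (V := R_CompleteNormedModule)); auto. now exists 0. }
  assert (E0 : rint W' a (a + PI / 2) = 0) by now apply is_RInt_unique.
  rewrite E, E0, rint_minus, rint_scal in H by cont_tac.
  lra.
Qed.

Lemma cont_shift f c : cont f -> cont (fun x => f (x + c)).
Proof.
  intros Hf x. apply (continuous_comp (fun y => y + c) f); [|apply Hf].
  apply (ex_derive_continuous (V := R_NormedModule)). auto_derive; auto.
Qed.

Lemma cont_continuity f : cont f -> continuity f.
Proof. intros Hf x. apply continuity_pt_filterlim, Hf. Qed.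

(* The alternating sum over [c + j PI/2], [j < 4], changes sign under
   [c -> c + PI/2]. *)
Lemma quarter_alternating_zero f : cont f -> periodic f ->
  exists c, f c - f (c + PI / 2) + f (c + PI) - f (c + 3 * (PI / 2)) = 0.
Proof.
  intros Cf Pf.
  set (d := fun c => f c - f (c + PI / 2) + f (c + PI) - f (c + 3 * (PI / 2))).
  assert (E : d (PI / 2) = - d 0).
  { unfold d. replace (PI / 2 + 3 * (PI / 2)) with (0 + 2 * PI) by field.
    rewrite Pf. replace (PI / 2 + PI / 2) with (0 + PI) by field.
    replace (PI / 2 + PI) with (0 + 3 * (PI / 2)) by field.
    replace (PI / 2) with (0 + PI / 2) at 1 by ring. ring. }
  destruct (IVT_gen d 0 (PI / 2) 0) as [c [_ Hc]].
  - apply cont_continuity. unfold d.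
    cont_tac; now apply cont_shift.
  - rewrite E. unfold Rmin, Rmax. repeat destruct Rle_dec; lra.
  - now exists c.
Qed.

(** * Projection on the first mode and the spectral gap *)

(** The coefficients are left free because two choices occur: Fourier coefficients for Bessel's
    inequality, interpolation coefficients for the Wirtinger inequality. *)
Lemma tint_dist_mode1 f al be ga : cont f ->
  tint (fun x => (f x - al - be * cos x - ga * sin x) ^ 2)
  = tint (fun x => f x ^ 2) + 2 * PI * al ^ 2 - 2 * al * tint f + PI * (be ^ 2 + ga ^ 2)
    - 2 * (be * tint (fun x => f x * cos x) + ga * tint (fun x => f x * sin x)).
Proof.
  intros Cf.
  rewrite (rint_ext _ (fun x => (1 * f x ^ 2 + (-2 * al) * f x + (-2 * be) * (f x * cos x)
       + (-2 * ga) * (f x * sin x))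
     + ((be ^ 2) * (cos x * cos x) + ga ^ 2 * (sin x * sin x) + (2 * be * ga) * (cos x * sin x)
     + 1 * (al ^ 2 + (2 * al * be) * cos x + (2 * al * ga) * sin x)))) by (intros; ring).
  rewrite rint_plus, !tint_lin4 by cont_tac.
  rewrite !rint_plus, !rint_scal, tint_sin2, tint_cos2, tint_cos_sin, tint_cos, tint_sin,
    rint_const by cont_tac.
  ring.
Qed.

Lemma tint_derive_sin (f f' : R -> R) :
  (forall x, is_derive f x (f' x)) -> cont f' -> periodic f ->
  tint (fun x => f' x * sin x) = - tint (fun x => f x * cos x).
Proof.
  intros Hf Cf' Pf. apply tint_by_parts; try cont_tac; auto using periodic_sin.
  intros x; auto_derive; auto; ring.
Qed.

Lemma tint_derive_cos (f f' : R -> R) :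
  (forall x, is_derive f x (f' x)) -> cont f' -> periodic f ->
  tint (fun x => f' x * cos x) = tint (fun x => f x * sin x).
Proof.
  intros Hf Cf' Pf. assert (Cf := cont_derive _ _ Hf).
  rewrite (tint_by_parts f f' cos (fun x => - sin x)); try cont_tac; auto using periodic_cos.
  - rewrite (rint_ext _ (fun x => (-1) * (f x * sin x))) by (intros; ring).
    rewrite rint_scal by cont_tac. ring.
  - intros x; auto_derive; auto; ring.
Qed.

(** The squared [L^2] norm of the orthogonal projection on the span of [cos] and [sin], both of
    which have squared norm [PI]. *)
Definition mode1 (f : R -> R) : R :=
  (tint (fun x => f x * cos x) ^ 2 + tint (fun x => f x * sin x) ^ 2) / PI.

Lemma mode1_nonneg f : 0 <= mode1 f.
Proof.
  apply Rmult_le_pos; [|left; apply Rinv_0_lt_compat, PI_RGT_0].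
  apply Rplus_le_le_0_compat; apply pow2_ge_0.
Qed.

(** The right-hand side is the squared [L^2] norm of [f] minus its mean and its first mode, that is,
    the energy of the frequencies at least [2]. *)
Lemma bessel_mode1 f : cont f ->
  0 <= tint (fun x => f x ^ 2) - mode1 f - tint f ^ 2 / (2 * PI).
Proof.
  intros Cf. assert (HP := PI_RGT_0).
  set (I1 := tint (fun x => f x * cos x)). set (I2 := tint (fun x => f x * sin x)).
  assert (H : 0 <= tint (fun x => (f x - tint f / (2 * PI) - I1 / PI * cos x - I2 / PI * sin x) ^ 2)).
  { apply tint_nonneg; [cont_tac|]. intros x. apply pow2_ge_0. }
  rewrite tint_dist_mode1 in H by auto. fold I1 I2 in H.
  replace (_ - _ - _) with
   (tint (fun x => f x ^ 2) + 2 * PI * (tint f / (2 * PI)) ^ 2 -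
     2 * (tint f / (2 * PI)) * tint f + PI * ((I1 / PI) ^ 2 + (I2 / PI) ^ 2) -
     2 * (I1 / PI * I1 + I2 / PI * I2)); auto.
  unfold mode1. fold I1 I2. field. lra.
Qed.

(** Fourier series are bypassed. Subtracting a trigonometric polynomial of degree one makes [f]
    vanish at four equidistant points, and the Dirichlet inequality applies on each quarter period.
    Four conditions on three coefficients are solvable because the alternating sum vanishes at [c].
    Completing squares then passes from the interpolation coefficients to the Fourier ones. *)
Lemma wirtinger_gap (f f' : R -> R) :
  (forall x, is_derive f x (f' x)) -> cont f' -> periodic f ->
  9 / 4 * (tint (fun x => f x ^ 2) - mode1 f - tint f ^ 2 / (2 * PI))
  <= tint (fun x => f' x ^ 2) - mode1 f.
Proof.
  intros Hf Cf' Pf. assert (Cf := cont_derive _ _ Hf). assert (HP := PI_RGT_0).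
  assert (Pf' := periodic_derive _ _ Pf Hf).
  destruct (quarter_alternating_zero f Cf Pf) as [c Hc].
  (* The interpolant is [al + b1 cos (x - c) + b2 sin (x - c)]; [be] and [ga] are its coefficients
     in the unshifted basis. *)
  set (al := (f c + f (c + PI)) / 2).
  set (b1 := (f c - f (c + PI)) / 2). set (b2 := (f (c + PI / 2) - f (c + 3 * (PI / 2))) / 2).
  set (be := b1 * cos c - b2 * sin c). set (ga := b1 * sin c + b2 * cos c).
  set (g := fun x => f x - al - be * cos x - ga * sin x).
  set (g' := fun x => f' x + be * sin x - ga * cos x).
  assert (Hg : forall x, is_derive g x (g' x)).
  { intros x. unfold g, g'. assert (H := Hf x). auto_derive.
    - repeat split. now exists (f' x).
    - assert (E : Derive (fun x => f x) x = f' x) by now apply is_derive_unique. rewrite E. ring. }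
  assert (Cg' : cont g') by (unfold g'; cont_tac).
  assert (Cg : cont g) by (apply (cont_derive _ _ Hg)).
  assert (Pg : periodic g) by (intros x; unfold g; rewrite Pf, periodic_cos, periodic_sin; auto).
  assert (Pg' := periodic_derive _ _ Pg Hg).
  assert (Hsc : sin c * sin c + cos c * cos c = 1) by (generalize (sin2_cos2 c); unfold Rsqr; auto).
  assert (Cc : cos (c + PI / 2) = - sin c) by (rewrite cos_plus, cos_PI2, sin_PI2; ring).
  assert (Sc : sin (c + PI / 2) = cos c) by (rewrite sin_plus, cos_PI2, sin_PI2; ring).
  assert (Z0 : g c = 0).
  { unfold g, be, ga. replace (f c - al - _ * cos c - _ * sin c)
      with (f c - al - b1 * (sin c * sin c + cos c * cos c)) by ring.
    rewrite Hsc. unfold al, b1. field. }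
  assert (Z1 : g (c + PI / 2) = 0).
  { unfold g, be, ga. rewrite Cc, Sc.
    replace (_ - _) with (f (c + PI / 2) - al - b2 * (sin c * sin c + cos c * cos c)) by ring.
    rewrite Hsc. unfold al, b2. lra. }
  assert (Z2 : g (c + PI / 2 + PI / 2) = 0).
  { replace (c + PI / 2 + PI / 2) with (c + PI) by field.
    unfold g, be, ga. rewrite neg_cos, neg_sin.
    replace (_ - _) with (f (c + PI) - al + b1 * (sin c * sin c + cos c * cos c)) by ring.
    rewrite Hsc. unfold al, b1. field. }
  assert (Z3 : g (c + PI / 2 + PI / 2 + PI / 2) = 0).
  { replace (c + PI / 2 + PI / 2 + PI / 2) with (c + 3 * (PI / 2)) by field.
    unfold g, be, ga. replace (c + 3 * (PI / 2)) with (c + PI / 2 + PI) at 2 3 by field.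
    rewrite neg_cos, neg_sin, Cc, Sc.
    replace (_ - _) with (f (c + 3 * (PI / 2)) - al + b2 * (sin c * sin c + cos c * cos c)) by ring.
    rewrite Hsc. unfold al, b2. lra. }
  assert (Z4 : g (c + PI / 2 + PI / 2 + PI / 2 + PI / 2) = 0).
  { replace (c + PI / 2 + PI / 2 + PI / 2 + PI / 2) with (c + 2 * PI) by field.
    now rewrite Pg. }
  assert (K : 9 / 4 * tint (fun x => g x ^ 2) <= tint (fun x => g' x ^ 2)).
  { rewrite <- (periodic_rint_shift (fun x => g x ^ 2) c), <- (periodic_rint_shift (fun x => g' x ^ 2) c);
      try cont_tac; try (intros x; now rewrite ?Pg, ?Pg').
    replace (c + 2 * PI) with (c + PI / 2 + PI / 2 + PI / 2 + PI / 2) by field.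
    assert (S : forall h, cont h -> rint h c (c + PI / 2 + PI / 2 + PI / 2 + PI / 2)
      = rint h c (c + PI / 2) + rint h (c + PI / 2) (c + PI / 2 + PI / 2)
        + rint h (c + PI / 2 + PI / 2) (c + PI / 2 + PI / 2 + PI / 2)
        + rint h (c + PI / 2 + PI / 2 + PI / 2) (c + PI / 2 + PI / 2 + PI / 2 + PI / 2)).
    { intros h Ch. now rewrite !rint_Chasles. }
    rewrite !S by cont_tac.
    assert (H0 := dirichlet_poincare g g' c Hg Cg' Z0 Z1).
    assert (H1 := dirichlet_poincare g g' _ Hg Cg' Z1 Z2).
    assert (H2 := dirichlet_poincare g g' _ Hg Cg' Z2 Z3).
    assert (H3 := dirichlet_poincare g g' _ Hg Cg' Z3 Z4). lra. }
  set (I1 := tint (fun x => f x * cos x)) in *. set (I2 := tint (fun x => f x * sin x)) in *.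
  assert (P1 := tint_derive_sin f f' Hf Cf' Pf). assert (P2 := tint_derive_cos f f' Hf Cf' Pf).
  fold I1 in P1. fold I2 in P2.
  assert (E1 : tint (fun x => g' x ^ 2) = tint (fun x => f' x ^ 2) + PI * (be ^ 2 + ga ^ 2) - 2 * (be * I1 + ga * I2)).
  { rewrite (rint_ext _ (fun x => (1 * f' x ^ 2 + (2 * be) * (f' x * sin x) + (-2 * ga) * (f' x * cos x)
       + 1 * (be ^ 2 * (sin x * sin x) + ga ^ 2 * (cos x * cos x) - (2 * be * ga) * (cos x * sin x))))).
    2: { intros x. unfold g'. ring. }
    rewrite tint_lin4 by cont_tac. rewrite P1, P2.
    rewrite rint_minus, rint_plus, !rint_scal, tint_sin2, tint_cos2, tint_cos_sin by cont_tac.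
    ring. }
  assert (E2 := tint_dist_mode1 f al be ga Cf). fold I1 I2 in E2.
  change (fun x => g x ^ 2) with (fun x => (f x - al - be * cos x - ga * sin x) ^ 2) in K.
  rewrite E1, E2 in K.
  set (N := tint (fun x => f x ^ 2)) in *. set (D := tint (fun x => f' x ^ 2)) in *.
  set (M := tint f) in *.
  (* The first-mode terms occur on both sides of [K], with net factor [9 / 4 - 1 > 0], so the lower
     bounds from [Q1] and [Q2] point the right way. *)
  assert (Q1 : 0 <= 2 * PI * (al - M / (2 * PI)) ^ 2).
  { apply Rmult_le_pos; [lra | apply pow2_ge_0]. }
  assert (Q2 : 0 <= PI * ((be - I1 / PI) ^ 2 + (ga - I2 / PI) ^ 2)).
  { apply Rmult_le_pos; [lra | apply Rplus_le_le_0_compat; apply pow2_ge_0]. }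
  replace (2 * PI * (al - M / (2 * PI)) ^ 2) with (2 * PI * al ^ 2 - 2 * al * M + M ^ 2 / (2 * PI)) in Q1
    by (field; lra).
  replace (PI * ((be - I1 / PI) ^ 2 + (ga - I2 / PI) ^ 2)) with
    (PI * (be ^ 2 + ga ^ 2) - 2 * (be * I1 + ga * I2) + mode1 f) in Q2
    by (unfold mode1; fold I1 I2; field; lra).
  lra.
Qed.

(** * The growth inequality *)

(** The derivative of [atan t - t] is [- t^2 / (1 + t^2)]. The cubic order makes the replacement of
    [atan r_x] by [r_x] cost only a small multiple of a quadratic form. *)
Lemma atan_sub_abs_le y : Rabs (atan y - y) <= y ^ 2 * Rabs y.
Proof.
  destruct (MVT_gen (fun t => atan t - t) 0 y (fun t => / (1 + t²) - 1)) as [c [Hc E]].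
  - intros x _. auto_derive; auto. unfold Rsqr; field.
    apply Rgt_not_eq. generalize (Rle_0_sqr x); unfold Rsqr; lra.
  - intros x _. apply continuity_pt_filterlim.
    apply (cont_minus atan (fun t => t)).
    + intros z. apply continuous_atan.
    + intros z. apply continuous_id.
  - rewrite atan_0, !Rminus_0_r in E. rewrite E, Rabs_mult.
    apply Rmult_le_compat_r; [apply Rabs_pos|].
    assert (Hc2 : c ^ 2 <= y ^ 2).
    { revert Hc. unfold Rmin, Rmax. destruct Rle_dec; intros; nra. }
    assert (0 <= c ^ 2) by apply pow2_ge_0.
    replace (/ (1 + c²) - 1) with (- (c ^ 2 / (1 + c ^ 2))) by (unfold Rsqr; field; lra).
    rewrite Rabs_Ropp, Rabs_pos_eq.
    + apply Rle_trans with (c ^ 2); auto.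
      apply Rmult_le_reg_r with (1 + c ^ 2); [lra|].
      unfold Rdiv. rewrite Rmult_assoc, Rinv_l by lra. nra.
    + apply Rmult_le_pos; auto. left; apply Rinv_0_lt_compat; lra.
Qed.

Lemma sqrt_1_sqr_bounds y : 1 <= sqrt (1 + y ^ 2) <= 1 + y ^ 2 / 2.
Proof.
  assert (0 <= y ^ 2) by apply pow2_ge_0. split.
  - rewrite <- sqrt_1 at 1. apply sqrt_le_1_alt. lra.
  - rewrite <- (sqrt_pow2 (1 + y ^ 2 / 2)) by lra. apply sqrt_le_1_alt. nra.
Qed.

Lemma sqrt_1_sqr_sq y : sqrt (1 + y ^ 2) * sqrt (1 + y ^ 2) = 1 + y ^ 2.
Proof. apply sqrt_sqrt. assert (0 <= y ^ 2) by apply pow2_ge_0. lra. Qed.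

Lemma Rabs_mul_le a b A B : Rabs a <= A -> Rabs b <= B -> Rabs (a * b) <= A * B.
Proof.
  intros. rewrite Rabs_mult. apply Rmult_le_compat; auto using Rabs_pos.
Qed.

(** The linearisation, done pointwise on real numbers: [y], [w], [h], [q] stand for [r_x], [v],
    [hmean r], [sqrt (1 + r_x^2)], and [P], [Q] for [p] and its derivative. The remainders come from
    [atan] ([T1]), from [1 / r] ([T2]) and from the length element ([T3]). The last two are
    quadratic and gain a factor [eps] from the multiplier [2 P - w], bounded by [9 eps]. *)
Lemma flow_integrand_bound rs eps y P Q w h q :
  0 < rs < 1 -> 0 < eps <= rs / 4 -> Rabs y <= eps -> Rabs w <= eps ->
  Rabs P <= 4 * eps -> 0 <= h <= 2 / rs -> 1 <= q <= 1 + y ^ 2 / 2 ->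
  y ^ 2 - 2 * (Q * y) - eps * (y ^ 2 + Q ^ 2) + (h - / rs) * (2 * P - w)
   + / rs ^ 2 * (2 * P * w - w ^ 2) - 18 * eps / rs ^ 3 * w ^ 2 - 9 * eps / rs * y ^ 2
  <= - (atan y * (2 * Q - y)) + (- / (rs + w) + h * q) * (2 * P - w).
Proof.
  intros Hrs Heps Hy Hw HP Hh Hq.
  assert (Hpsi : Rabs (2 * P - w) <= 9 * eps).
  { apply Rabs_le. apply Rabs_le_between in HP. apply Rabs_le_between in Hw. lra. }
  assert (Hy2 : 0 <= y ^ 2) by apply pow2_ge_0.
  assert (Hw2 : 0 <= w ^ 2) by apply pow2_ge_0.
  assert (T1 : Rabs ((atan y - y) * (2 * Q - y)) <= eps * (y ^ 2 + Q ^ 2)).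
  { rewrite Rabs_mult.
    apply Rle_trans with (y ^ 2 * Rabs y * (2 * Rabs Q + Rabs y)).
    - apply Rmult_le_compat; auto using Rabs_pos, atan_sub_abs_le.
      unfold Rminus. eapply Rle_trans; [apply Rabs_triang|].
      rewrite Rabs_Ropp, Rabs_mult, (Rabs_pos_eq 2) by lra. lra.
    - rewrite <- (pow2_abs y), <- (pow2_abs Q).
      assert (H1 := Rabs_pos y). assert (H2 := Rabs_pos Q).
      set (a := Rabs y) in *. set (b := Rabs Q) in *.
      apply Rle_trans with (eps ^ 2 * (a * (2 * b + a))).
      + replace (a ^ 2 * a * (2 * b + a)) with (a ^ 2 * (a * (2 * b + a))) by ring.
        apply Rmult_le_compat_r; [nra|]. apply pow_incr; lra.
      + apply Rle_trans with (eps * (2 * eps * (a ^ 2 + b ^ 2))).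
        * replace (eps * (2 * eps * (a ^ 2 + b ^ 2))) with (eps ^ 2 * (2 * (a ^ 2 + b ^ 2))) by ring.
          apply Rmult_le_compat_l; [apply pow2_ge_0|]. nra.
        * apply Rmult_le_compat_l; [lra|]. nra. }
  apply Rabs_le_between in T1.
  assert (Hw' := Hw). apply Rabs_le_between in Hw'.
  assert (Hr : 3 / 4 * rs <= rs + w) by lra.
  assert (Hr3 : 0 < rs ^ 3) by (apply pow_lt; lra).
  assert (T2 : Rabs (w ^ 2 / (rs ^ 2 * (rs + w)) * (2 * P - w)) <= 18 * eps / rs ^ 3 * w ^ 2).
  { apply Rle_trans with (w ^ 2 * (2 / rs ^ 3) * (9 * eps)).
    - apply Rabs_mul_le; auto.
      assert (Hpos : 0 < rs ^ 2 * (rs + w)) by (apply Rmult_lt_0_compat; [apply pow_lt|]; lra).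
      rewrite Rabs_pos_eq.
      + apply Rmult_le_compat_l; auto.
        replace (2 / rs ^ 3) with (/ (rs ^ 3 / 2)) by (field; lra).
        apply Rinv_le_contravar; [lra|].
        replace (rs ^ 3 / 2) with (rs ^ 2 * (rs / 2)) by field.
        apply Rmult_le_compat_l; [apply pow2_ge_0|lra].
      + apply Rmult_le_pos; auto. left; now apply Rinv_0_lt_compat.
    - right. field. lra. }
  apply Rabs_le_between in T2.
  assert (T3 : Rabs (h * (q - 1) * (2 * P - w)) <= 9 * eps / rs * y ^ 2).
  { apply Rle_trans with (2 / rs * (y ^ 2 / 2) * (9 * eps)).
    - apply Rabs_mul_le; auto. apply Rabs_mul_le; rewrite Rabs_pos_eq; lra.
    - right. field. lra. }
  apply Rabs_le_between in T3.
  (* Exact expansion, with [1 / (rs + w) = 1 / rs - w / rs^2 + w^2 / (rs^2 (rs + w))]. *)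
  replace (- (atan y * (2 * Q - y)) + (- / (rs + w) + h * q) * (2 * P - w)) with
    (y ^ 2 - 2 * (Q * y) + (h - / rs) * (2 * P - w) + / rs ^ 2 * (2 * P * w - w ^ 2)
     - (atan y - y) * (2 * Q - y) - w ^ 2 / (rs ^ 2 * (rs + w)) * (2 * P - w)
     + h * (q - 1) * (2 * P - w)) by (field; lra).
  lra.
Qed.

(** * The operator at a fixed time, for a positive periodic [C^2] profile *)

Section ProfileC2.

Variables r r1 r2 : R -> R.
Hypothesis Hr1 : forall x, is_derive r x (r1 x).
Hypothesis Hr2 : forall x, is_derive r1 x (r2 x).
Hypothesis Cr2 : cont r2.
Hypothesis Pr : periodic r.
Hypothesis Rpos : forall x, 0 < r x.

Let Cr : cont r := cont_derive _ _ Hr1.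
Let Cr1 : cont r1 := cont_derive _ _ Hr2.
Let s x := sqrt (1 + r1 x ^ 2).

Lemma Derive_profile x : Derive r x = r1 x.
Proof. apply is_derive_unique, Hr1. Qed.

Lemma Derive2_profile x : Derive_n r 2 x = r2 x.
Proof.
  simpl. rewrite (Derive_ext _ r1) by apply Derive_profile.
  apply is_derive_unique, Hr2.
Qed.

Lemma one_r1_pos x : 0 < 1 + r1 x ^ 2.
Proof. assert (0 <= r1 x ^ 2) by apply pow2_ge_0. lra. Qed.

Lemma atan_r1_derive x : is_derive (fun x => atan (r1 x)) x (r2 x / (1 + r1 x ^ 2)).
Proof.
  evar_last. { apply (is_derive_comp atan r1); [apply is_derive_atan|apply Hr2]. }
  unfold scal; simpl; unfold mult; simpl. unfold Rsqr. field.
  generalize (one_r1_pos x); simpl; lra.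
Qed.

Lemma cont_curv : cont (fun x => r2 x / (1 + r1 x ^ 2)).
Proof.
  apply cont_div; auto; [cont_tac|].
  intros x. apply Rgt_not_eq, one_r1_pos.
Qed.

Lemma periodic_r1 : periodic r1.
Proof. exact (periodic_derive _ _ Pr Hr1). Qed.

Lemma tint_curv_parts (g g' : R -> R) : (forall x, is_derive g x (g' x)) -> cont g' -> periodic g ->
  tint (fun x => r2 x / (1 + r1 x ^ 2) * g x) = - tint (fun x => atan (r1 x) * g' x).
Proof.
  intros Hg Cg Pg. apply (tint_by_parts (fun x => atan (r1 x))); auto.
  - apply atan_r1_derive.
  - apply cont_curv.
  - intros x. now rewrite periodic_r1.
Qed.

(** The outer square root cancels one factor in each curvature term, so [r_xx] survives only inside
    the derivative of [atan r_x]. *)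
Lemma Gop_profile x :
  Gop r x = r2 x / (1 + r1 x ^ 2) - / r x + hmean r * s x.
Proof.
  unfold Gop, Hcurv. rewrite Derive_profile, Derive2_profile. fold (s x).
  assert (H1 := one_r1_pos x). assert (H2 : s x * s x = 1 + r1 x ^ 2) by apply sqrt_1_sqr_sq.
  assert (H3 : 1 <= s x) by apply sqrt_1_sqr_bounds. specialize (Rpos x).
  rewrite <- H2. field. lra.
Qed.

Lemma cont_Gop : cont (Gop r).
Proof.
  intros x. apply (continuous_ext (fun x => r2 x / (1 + r1 x ^ 2) - / r x + hmean r * s x)).
  { intros y. symmetry. apply Gop_profile. }
  revert x. apply (cont_plus (fun x => r2 x / (1 + r1 x ^ 2) - / r x)).
  - apply cont_minus; [apply cont_curv|]. apply cont_inv; auto.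
    intros x. apply Rgt_not_eq, Rpos.
  - unfold s. cont_tac.
Qed.

Lemma Sarea_profile : Sarea r = tint (fun x => r x * s x).
Proof.
  apply RInt_ext. intros x _. now rewrite Derive_profile.
Qed.

(** The integrand of the mean curvature is [1 - r r_xx / (1 + r_x^2)]. Integrating by parts shows
    that [hmean] depends on [r] and [r_x] alone, hence is controlled by [C^1]-closeness. *)
Lemma hmean_profile :
  hmean r = (2 * PI + tint (fun x => atan (r1 x) * r1 x)) / Sarea r.
Proof.
  assert (E : tint (fun x => Hcurv r x * r x * sqrt (1 + Derive r x ^ 2))
    = 2 * PI + tint (fun x => atan (r1 x) * r1 x)).
  { rewrite (rint_ext _ (fun x => 1 - r2 x / (1 + r1 x ^ 2) * r x)).
    - assert (C := cont_curv). rewrite rint_minus.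
      + rewrite rint_const, (tint_curv_parts r r1); auto. ring.
      + cont_tac.
      + apply cont_mult; auto.
    - intros x. unfold Hcurv. rewrite Derive_profile, Derive2_profile. fold (s x).
      assert (H1 := one_r1_pos x). assert (H2 : s x * s x = 1 + r1 x ^ 2) by apply sqrt_1_sqr_sq.
      assert (H3 : 1 <= s x) by apply sqrt_1_sqr_bounds. specialize (Rpos x).
      rewrite <- H2. field. lra. }
  unfold hmean. change (RInt ?f (- PI) PI) with (tint f). rewrite E. apply Rmult_comm.
Qed.

(** * Estimates for profiles that are [C^1]-close to the equilibrium *)

Variables rs eps : R.
Hypothesis Hrs : 0 < rs < 1.
Hypothesis Heps : 0 < eps <= rs / 4.
Hypothesis Hv : forall x, Rabs (r x - rs) <= eps.
Hypothesis Hv1 : forall x, Rabs (r1 x) <= eps.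

Let v x := r x - rs.
Let M := tint v.
Let N := tint (fun x => v x ^ 2).
Let D := tint (fun x => r1 x ^ 2).

Lemma cont_v : cont v.
Proof. unfold v. cont_tac. Qed.

Lemma r1_sq_le x : r1 x ^ 2 <= eps ^ 2.
Proof. rewrite <- (pow2_abs (r1 x)). apply pow_incr. split; [apply Rabs_pos|apply Hv1]. Qed.

Lemma atan_r1_bounds x : 0 <= atan (r1 x) * r1 x <= r1 x ^ 2.
Proof.
  assert (HP := PI_RGT_0).
  destruct (MVT_gen atan 0 (r1 x) (fun t => / (1 + t²))) as [c [_ E]].
  - intros; apply is_derive_atan.
  - intros. apply continuity_pt_filterlim, continuous_atan.
  - rewrite atan_0, !Rminus_0_r in E. rewrite E, Rmult_assoc.
    replace (r1 x * r1 x) with (r1 x ^ 2) by ring.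
    assert (0 <= r1 x ^ 2) by apply pow2_ge_0. assert (0 <= c²) by apply Rle_0_sqr.
    split.
    + apply Rmult_le_pos; auto. left; apply Rinv_0_lt_compat; lra.
    + rewrite <- (Rmult_1_l (r1 x ^ 2)) at 2. apply Rmult_le_compat_r; auto.
      rewrite <- Rinv_1. apply Rinv_le_contravar; lra.
Qed.

Lemma tint_atan_r1_bounds : 0 <= tint (fun x => atan (r1 x) * r1 x) <= D.
Proof.
  split.
  - apply tint_nonneg; [cont_tac|]. intros x. apply atan_r1_bounds.
  - apply tint_le; try cont_tac. intros x. apply atan_r1_bounds.
Qed.

Lemma D_bounds : 0 <= D <= 2 * PI * eps ^ 2.
Proof.
  split.
  - apply tint_nonneg; [cont_tac|]. intros x. apply pow2_ge_0.
  - replace (2 * PI * eps ^ 2) with (eps ^ 2 * (PI - - PI)) by ring.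
    rewrite <- rint_const. apply tint_le; try cont_tac. apply r1_sq_le.
Qed.

Lemma M_bound : Rabs M <= 2 * PI * eps.
Proof. apply tint_abs_le; [apply cont_v|apply Hv]. Qed.

Lemma Sarea_bounds :
  2 * PI * rs + M <= Sarea r <= 2 * PI * rs + M + rs * D.
Proof.
  rewrite Sarea_profile.
  assert (E : tint (fun x => rs * 1 + 1 * v x + 0 * v x + 0 * v x) = 2 * PI * rs + M).
  { assert (Cv := cont_v). rewrite tint_lin4 by cont_tac. rewrite rint_const. fold M. ring. }
  assert (E' : tint (fun x => rs * 1 + 1 * v x + rs * r1 x ^ 2 + 0 * v x) = 2 * PI * rs + M + rs * D).
  { assert (Cv := cont_v). rewrite tint_lin4 by cont_tac. rewrite rint_const. fold M D. ring. }
  rewrite <- E', <- E. assert (Cv := cont_v).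
  split; apply tint_le; try (unfold s; cont_tac); intros x; unfold v; fold (s x);
    assert (H := sqrt_1_sqr_bounds (r1 x)); assert (H1 := Rpos x);
    assert (H2 := Hv x); apply Rabs_le_between in H2; assert (0 <= r1 x ^ 2) by apply pow2_ge_0; fold (s x) in H; nra.
Qed.

Lemma hmean_bound : 0 <= hmean r <= 2 / rs.
Proof.
  rewrite hmean_profile. assert (HS := Sarea_bounds). assert (HM := M_bound). assert (HP := PI_RGT_0).
  apply Rabs_le_between in HM.
  (* From [eps <= rs / 4], which gives [|M| <= PI rs / 2]. *)
  assert (HS2 : 3 / 2 * PI * rs <= Sarea r) by nra.
  assert (HD := D_bounds).
  assert (HA := tint_atan_r1_bounds).
  assert (eps ^ 2 <= 1 / 16) by nra.
  assert (0 < PI * rs) by (apply Rmult_lt_0_compat; lra).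
  split.
  - apply Rmult_le_pos; [lra|]. left; apply Rinv_0_lt_compat; lra.
  - apply Rmult_le_reg_r with (Sarea r); [lra|].
    unfold Rdiv at 1. rewrite Rmult_assoc, Rinv_l, Rmult_1_r by lra.
    apply Rle_trans with (2 / rs * (3 / 2 * PI * rs)).
    + replace (2 / rs * (3 / 2 * PI * rs)) with (3 * PI) by (field; lra). nra.
    + apply Rmult_le_compat_l; auto. apply Rmult_le_pos; [lra|]. left; apply Rinv_0_lt_compat; lra.
Qed.

(* The mean curvature responds to the mean of [v] with the sign that cancels
   the constant mode of [v / rs ^ 2]. *)
Lemma hmean_mean_response :
  M ^ 2 / (2 * PI * rs ^ 2) - 2 * eps / rs ^ 3 * N - 4 * eps / rs ^ 2 * D
  <= (hmean r - / rs) * - M.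
Proof.
  assert (HS := Sarea_bounds). assert (HM := M_bound). assert (HP := PI_RGT_0).
  assert (HB := bessel_mode1 v cont_v). fold M N in HB.
  assert (HM0 := mode1_nonneg v).
  assert (HD := D_bounds).
  assert (HM' := HM). apply Rabs_le_between in HM'.
  assert (HS2 : 3 / 2 * PI * rs <= Sarea r) by nra.
  assert (HS3 : Sarea r <= 2 * PI * (rs + 2 * eps)) by nra.
  assert (HA := tint_atan_r1_bounds).
  rewrite hmean_profile. set (K := tint (fun x => atan (r1 x) * r1 x)) in *.
  set (S := Sarea r) in *.
  assert (0 < PI * rs) by (apply Rmult_lt_0_compat; lra).
  assert (HS0 : 0 < S) by lra.
  (* Chosen so that [hmean r - 1 / rs = - (M + E) / (rs S)]. Both [S - 2 PI rs - M] and [rs K] lie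
     between [0] and [rs D], so [E] is of second order. *)
  set (E := S - 2 * PI * rs - M - rs * K).
  assert (HE : Rabs E <= D).
  { apply Rabs_le. unfold E. nra. }
  replace ((_ - _) * - M) with (M ^ 2 / (rs * S) + E * M / (rs * S)).
  2: { unfold E. field. lra. }
  (* Rests on [(rs - 2 eps) (rs + 2 eps) <= rs^2]; the loss is charged to [N] through
     [M^2 / (2 PI) <= N]. *)
  assert (H1 : M ^ 2 / (2 * PI * rs ^ 2) - 2 * eps / rs ^ 3 * N <= M ^ 2 / (rs * S)).
  { apply Rle_trans with (M ^ 2 / (2 * PI) * (/ rs ^ 2 - 2 * eps / rs ^ 3)).
    - replace (M ^ 2 / (2 * PI) * (/ rs ^ 2 - 2 * eps / rs ^ 3)) with
        (M ^ 2 / (2 * PI * rs ^ 2) - 2 * eps / rs ^ 3 * (M ^ 2 / (2 * PI))) by (field; lra).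
      assert (2 * eps / rs ^ 3 * (M ^ 2 / (2 * PI)) <= 2 * eps / rs ^ 3 * N); [|lra].
      apply Rmult_le_compat_l; [|lra].
      apply Rmult_le_pos; [lra|]. left; apply Rinv_0_lt_compat, pow_lt; lra.
    - apply Rmult_le_reg_r with (2 * PI * (rs ^ 3 * S)).
      { apply Rmult_lt_0_compat; [lra|]. apply Rmult_lt_0_compat; auto. apply pow_lt; lra. }
      replace (M ^ 2 / (2 * PI) * (/ rs ^ 2 - 2 * eps / rs ^ 3) * (2 * PI * (rs ^ 3 * S)))
        with (M ^ 2 * ((rs - 2 * eps) * S)) by (field; lra).
      replace (M ^ 2 / (rs * S) * (2 * PI * (rs ^ 3 * S))) with (M ^ 2 * (2 * PI * rs ^ 2)) by (field; lra).
      apply Rmult_le_compat_l; [apply pow2_ge_0|].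
      apply Rle_trans with ((rs - 2 * eps) * (2 * PI * (rs + 2 * eps))); [|nra].
      apply Rmult_le_compat_l; lra. }
  assert (H2 : - (4 * eps / rs ^ 2 * D) <= E * M / (rs * S)).
  { assert (H3 : Rabs (E * M) <= D * (2 * PI * eps)) by now apply Rabs_mul_le.
    apply Rabs_le_between in H3.
    apply Rmult_le_reg_r with (rs * S); [nra|].
    replace (E * M / (rs * S) * (rs * S)) with (E * M) by (field; lra).
    apply Rle_trans with (- (D * (2 * PI * eps))); [|lra].
    replace (- (4 * eps / rs ^ 2 * D) * (rs * S)) with (- (D * (4 * eps / rs * S))) by (field; lra).
    apply Ropp_le_contravar, Rmult_le_compat_l; [lra|].
    apply Rle_trans with (4 * eps / rs * (3 / 2 * PI * rs)).
    - replace (4 * eps / rs * (3 / 2 * PI * rs)) with (6 * PI * eps) by (field; lra). nra.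
    - apply Rmult_le_compat_l; auto. apply Rmult_le_pos; [lra|]. left; apply Rinv_0_lt_compat; lra. }
  lra.
Qed.

Let be := tint (fun x => v x * cos x) / PI.
Let ga := tint (fun x => v x * sin x) / PI.

Lemma mode1_coefs : mode1 v = PI * (be ^ 2 + ga ^ 2).
Proof. unfold mode1, be, ga. field. apply PI_neq0. Qed.

(** The quadratic form of the linearised flow: [D - 2 mode1 v] comes from diffusion, the [1 / rs^2]
    term from expanding [- 1 / r], and the [M^2] term from the nonlocal part. The last term on the
    left collects all errors. *)
Lemma flow_against_cone :
  D - 2 * mode1 v + (2 * mode1 v - N) / rs ^ 2 + M ^ 2 / (2 * PI * rs ^ 2)
   - 20 * eps / rs ^ 3 * (2 * N + D)
  <= tint (fun x => Gop r x * (2 * (be * cos x + ga * sin x) - v x)).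
Proof.
  assert (Cv := cont_v). assert (HP := PI_RGT_0).
  assert (Hv' : forall x, is_derive v x (r1 x)) by (intros x; apply is_derive_minus_const, Hr1).
  assert (Pv : periodic v) by (intros x; unfold v; now rewrite Pr).
  (* [P] is the projection [p] of [v], and [Q] is its derivative. *)
  set (P := fun x => be * cos x + ga * sin x). set (Q := fun x => ga * cos x - be * sin x).
  assert (CP : cont P) by (unfold P; cont_tac). assert (CQ : cont Q) by (unfold Q; cont_tac).
  assert (Crv : cont (fun x => / r x)).
  { apply cont_inv; auto. intros x; apply Rgt_not_eq, Rpos. }
  assert (Cs : cont s) by (unfold s; cont_tac).
  assert (Hbe : Rabs be <= 2 * eps /\ Rabs ga <= 2 * eps).
  { assert (HI : forall c, cont c -> (forall x, Rabs (c x) <= 1) ->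
      Rabs (tint (fun x => v x * c x) / PI) <= 2 * eps).
    { intros c Cc Hc. unfold Rdiv. rewrite Rabs_mult, (Rabs_pos_eq (/ PI)).
      2: left; now apply Rinv_0_lt_compat.
      apply Rmult_le_reg_r with PI; auto. rewrite Rmult_assoc, Rinv_l, Rmult_1_r by lra.
      replace (2 * eps * PI) with (2 * PI * eps) by ring. apply tint_abs_le; [cont_tac|].
      intros x. rewrite <- (Rmult_1_r eps). apply Rabs_mul_le; auto. apply Hv. }
    split; apply HI; try cont_tac; intros x; apply Rabs_le.
    - apply COS_bound.
    - apply SIN_bound. }
  assert (HPb : forall x, Rabs (P x) <= 4 * eps).
  { intros x. unfold P. eapply Rle_trans; [apply Rabs_triang|].
    replace (4 * eps) with (2 * eps * 1 + 2 * eps * 1) by ring.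
    apply Rplus_le_compat; apply Rabs_mul_le; try apply Hbe; apply Rabs_le;
      [apply COS_bound | apply SIN_bound]. }
  assert (Hh := hmean_bound). assert (HA := mode1_coefs).
  assert (E : tint (fun x => Gop r x * (2 * P x - v x)) =
    tint (fun x => - (atan (r1 x) * (2 * Q x - r1 x)) + (- / r x + hmean r * s x) * (2 * P x - v x))).
  { rewrite (rint_ext _ (fun x => r2 x / (1 + r1 x ^ 2) * (2 * P x - v x)
       + (- / r x + hmean r * s x) * (2 * P x - v x))).
    2: { intros x. rewrite Gop_profile. fold (s x). ring. }
    assert (C1 := cont_curv).
    rewrite rint_plus, rint_plus; try cont_tac.
    f_equal. rewrite (tint_curv_parts _ (fun x => 2 * Q x - r1 x)).
    - rewrite (rint_ext (fun x => - _) (fun x => (-1) * (atan (r1 x) * (2 * Q x - r1 x)))) by (intros; ring).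
      rewrite rint_scal by cont_tac. ring.
    - intros x. unfold P, Q. assert (H := Hv' x). auto_derive.
      + repeat split. now exists (r1 x).
      + assert (E : Derive (fun x => v x) x = r1 x) by now apply is_derive_unique.
        rewrite E. ring.
    - cont_tac.
    - intros x. unfold P. now rewrite Pv, periodic_cos, periodic_sin. }
  unfold P in E. rewrite E. clear E. fold P.
  change (tint (fun x => - (atan (r1 x) * (2 * Q x - r1 x))
    + (- / r x + hmean r * s x) * (2 * (be * cos x + ga * sin x) - v x))) with
    (tint (fun x => - (atan (r1 x) * (2 * Q x - r1 x))
    + (- / r x + hmean r * s x) * (2 * P x - v x))).
  set (k := hmean r - / rs).
  apply Rle_trans with (tint (fun x =>
      (1 * r1 x ^ 2 + (- 2) * (Q x * r1 x) + (- eps) * (r1 x ^ 2 + Q x ^ 2) + (2 * k) * P x)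
     + ((- k) * v x + (2 * / rs ^ 2) * (P x * v x) + (- / rs ^ 2 - 18 * eps / rs ^ 3) * v x ^ 2
       + (- (9 * eps / rs)) * r1 x ^ 2))).
  2: { apply tint_le; try cont_tac. intros x.
    eapply Rle_trans; [|eapply Rle_trans; [apply (flow_integrand_bound rs eps (r1 x) (P x) (Q x) (v x) (hmean r) (s x))|]]; auto.
    - right. unfold k. ring.
    - apply Hv.
    - apply sqrt_1_sqr_bounds.
    - right. unfold v. replace (rs + (r x - rs)) with (r x) by ring. ring. }
  rewrite rint_plus, !tint_lin4, rint_plus by cont_tac.
  (* The integral of [p_x v_x]: it equals [|p|^2] because [- p_xx = p]. *)
  assert (EQ : tint (fun x => Q x * r1 x) = mode1 v).
  { rewrite (rint_ext _ (fun x => ga * (r1 x * cos x) - be * (r1 x * sin x))) by (intros; unfold Q; ring).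
    rewrite rint_minus, !rint_scal by cont_tac.
    rewrite (tint_derive_cos v r1), (tint_derive_sin v r1) by auto.
    unfold mode1, be, ga. field. lra. }
  assert (EQ2 : tint (fun x => Q x ^ 2) = mode1 v).
  { rewrite (rint_ext _ (fun x => ga ^ 2 * (cos x * cos x) + be ^ 2 * (sin x * sin x) + (- (2 * be * ga)) * (cos x * sin x)))
      by (intros; unfold Q; ring).
    rewrite !rint_plus, !rint_scal, tint_cos2, tint_sin2, tint_cos_sin by cont_tac. rewrite HA. ring. }
  assert (EP : tint P = 0).
  { unfold P. rewrite rint_plus, !rint_scal, tint_cos, tint_sin by cont_tac. ring. }
  assert (EPv : tint (fun x => P x * v x) = mode1 v).
  { rewrite (rint_ext _ (fun x => be * (v x * cos x) + ga * (v x * sin x))) by (intros; unfold P; ring).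
    rewrite rint_plus, !rint_scal by cont_tac. unfold mode1, be, ga. field. lra. }
  rewrite EQ, EQ2, EP, EPv. fold M N D.
  assert (HR := hmean_mean_response). fold k in HR.
  assert (HB := bessel_mode1 v Cv). fold M N in HB.
  assert (HM2 : 0 <= M ^ 2 / (2 * PI)).
  { apply Rmult_le_pos; [apply pow2_ge_0|]. left; apply Rinv_0_lt_compat; lra. }
  assert (HA0 := mode1_nonneg v).
  assert (HD := D_bounds).
  assert (Hr3 : 0 < rs ^ 3) by (apply pow_lt; lra).
  assert (HN : mode1 v <= N) by lra.
  (* Since [rs < 1], every error is dominated by a multiple of [eps / rs^3]. On [N] the constants
     [18] (from [1 / r]) and [2] (from [hmean]) add up to another [20], whence [2 * N] in the
     statement. *)
  assert (K1 : eps * (D + mode1 v) + 9 * eps / rs * D + 4 * eps / rs ^ 2 * D <= 20 * eps / rs ^ 3 * (N + D)).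
  { apply Rmult_le_reg_r with (rs ^ 3); auto.
    replace (20 * eps / rs ^ 3 * (N + D) * rs ^ 3) with (eps * (20 * (N + D))) by (field; lra).
    replace ((eps * (D + mode1 v) + 9 * eps / rs * D + 4 * eps / rs ^ 2 * D) * rs ^ 3) with
      (eps * ((D + mode1 v) * rs ^ 3 + 9 * rs ^ 2 * D + 4 * rs * D)) by (field; lra).
    apply Rmult_le_compat_l; [lra|].
    assert (rs ^ 2 <= 1) by nra. assert (rs ^ 3 <= 1) by (simpl in *; nra).
    assert ((D + mode1 v) * rs ^ 3 <= (D + mode1 v) * 1) by (apply Rmult_le_compat_l; lra).
    assert (rs ^ 2 * D <= 1 * D) by (apply Rmult_le_compat_r; lra).
    assert (rs * D <= 1 * D) by (apply Rmult_le_compat_r; lra). lra. }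
  replace (20 * eps / rs ^ 3 * (2 * N + D)) with
    (20 * eps / rs ^ 3 * (N + D) + 18 * eps / rs ^ 3 * N + 2 * eps / rs ^ 3 * N) by (field; lra).
  replace ((2 * mode1 v - N) / rs ^ 2) with (2 * / rs ^ 2 * mode1 v - / rs ^ 2 * N) by (field; lra).
  lra.
Qed.

(* Coefficientwise in [mode1 v], the higher modes and the mean: the gap
   constant [9/4 > 1] leaves room for the error [e]. *)
Lemma cone_growth e :
  e = 20 * eps / rs ^ 3 -> e <= 1 / 8 -> e <= (/ rs ^ 2 - 1) / 8 ->
  (/ rs ^ 2 - 1 - 3 * e) * (2 * mode1 v - N)
  <= tint (fun x => Gop r x * (2 * (be * cos x + ga * sin x) - v x)).
Proof.
  intros He He1 He2. eapply Rle_trans; [|apply flow_against_cone]. rewrite <- He.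
  assert (Cv := cont_v). assert (HP := PI_RGT_0).
  assert (Hv' : forall x, is_derive v x (r1 x)) by (intros x; apply is_derive_minus_const, Hr1).
  assert (Pv : periodic v) by (intros x; unfold v; now rewrite Pr).
  assert (HW := wirtinger_gap v r1 Hv' Cr1 Pv). fold M N D in HW.
  assert (HB := bessel_mode1 v Cv). fold M N in HB.
  assert (HM2 : 0 <= M ^ 2 / (2 * PI)).
  { apply Rmult_le_pos; [apply pow2_ge_0|]. left; apply Rinv_0_lt_compat; lra. }
  assert (HA0 := mode1_nonneg v).
  replace (M ^ 2 / (2 * PI * rs ^ 2)) with (/ rs ^ 2 * (M ^ 2 / (2 * PI))) by (field; lra).
  replace ((2 * mode1 v - N) / rs ^ 2) with (/ rs ^ 2 * (2 * mode1 v - N)) by (field; lra).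
  assert (He0 : 0 < e).
  { rewrite He. apply Rmult_lt_0_compat; [lra|]. apply Rinv_0_lt_compat, pow_lt; lra. }
  set (A := mode1 v) in *. set (m := M ^ 2 / (2 * PI)) in *. set (L := / rs ^ 2) in *.
  (* [B] is the energy of the frequencies at least [2]. On [A] the error costs exactly [3 e], twice
     through [N] and once through [D], which fixes the rate; [Y] and [Z] are the slack left for [B]
     and [m]. *)
  set (B := N - A - m) in *.
  replace N with (A + B + m) by (unfold B; ring).
  assert (X : (1 - e) * (9 / 4 * B) <= (1 - e) * (D - A)) by (apply Rmult_le_compat_l; lra).
  assert (Y : 0 <= (5 / 4 - 29 / 4 * e) * B) by (apply Rmult_le_pos; lra).
  assert (Z : 0 <= (L - 1 - 5 * e) * m) by (apply Rmult_le_pos; lra).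
  lra.
Qed.

End ProfileC2.

(** * Hölder norms *)

Lemma Rbar_plus_nonneg_lt (a b : Rbar) (e : R) :
  Rbar_le (Finite 0) a -> Rbar_le (Finite 0) b ->
  Rbar_lt (Rbar_plus a b) (Finite e) -> Rbar_lt a (Finite e) /\ Rbar_lt b (Finite e).
Proof.
  destruct a as [a| |], b as [b| |]; simpl; try tauto. intros; split; lra.
Qed.

Lemma Rbar_plus_nonneg (a b : Rbar) :
  Rbar_le (Finite 0) a -> Rbar_le (Finite 0) b -> Rbar_le (Finite 0) (Rbar_plus a b).
Proof. destruct a as [a| |], b as [b| |]; simpl; try tauto. intros; lra. Qed.

Lemma Lub_Rbar_nonneg (E : R -> Prop) v : E v -> 0 <= v -> Rbar_le (Finite 0) (Lub_Rbar E).
Proof.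
  intros Hv H0. apply Rbar_le_trans with (Finite v); [exact H0|].
  now apply (proj1 (Lub_Rbar_correct E)).
Qed.

Lemma Lub_Rbar_le (E : R -> Prop) (M : R) : (forall v, E v -> v <= M) -> Rbar_le (Lub_Rbar E) (Finite M).
Proof. intros H. apply (proj2 (Lub_Rbar_correct E)). intros v Hv. now apply H. Qed.

Lemma Lub_Rbar_lt (E : R -> Prop) (M v : R) : Rbar_lt (Lub_Rbar E) (Finite M) -> E v -> v < M.
Proof.
  intros H Hv. apply (Rbar_le_lt_trans (Finite v) (Lub_Rbar E) (Finite M)); auto.
  now apply (proj1 (Lub_Rbar_correct E)).
Qed.

Lemma sup_deriv_nonneg f j : Rbar_le (Finite 0) (sup_deriv f j).
Proof.
  apply Lub_Rbar_nonneg with (Rabs (Derive_n f j 0)); [now exists 0|apply Rabs_pos].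
Qed.

Lemma sum_sup_deriv_nonneg f k : Rbar_le (Finite 0) (sum_sup_deriv f k).
Proof.
  induction k as [|k IH]; simpl; [apply sup_deriv_nonneg|].
  apply Rbar_plus_nonneg; [exact IH|apply sup_deriv_nonneg].
Qed.

Lemma holder_semi_nonneg f k beta : Rbar_le (Finite 0) (holder_semi f k beta).
Proof.
  eapply Lub_Rbar_nonneg.
  - exists 0, 1. split; [lra|reflexivity].
  - apply Rmult_le_pos; [apply Rabs_pos|]. left. apply Rinv_0_lt_compat, exp_pos.
Qed.

Lemma sum_sup_deriv_lt f k e j x : Rbar_lt (sum_sup_deriv f k) (Finite e) -> (j <= k)%nat ->
  Rabs (Derive_n f j x) < e.
Proof.
  assert (Hsup : forall i, Rbar_lt (sup_deriv f i) (Finite e) -> Rabs (Derive_n f i x) < e).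
  { intros i Hi. apply (Lub_Rbar_lt _ _ _ Hi). now exists x. }
  induction k as [|k IH]; intros H Hj.
  - replace j with O by lia. now apply Hsup.
  - simpl sum_sup_deriv in H. apply Rbar_plus_nonneg_lt in H.
    2: apply sum_sup_deriv_nonneg. 2: apply sup_deriv_nonneg.
    destruct (Nat.eq_dec j (S k)) as [->|]; [now apply Hsup|apply IH; [apply H|lia]].
Qed.

Lemma hnorm_lt_sup sigma f e : Rbar_lt (hnorm sigma f) (Finite e) ->
  forall j x, (j <= hk sigma)%nat -> Rabs (Derive_n f j x) < e.
Proof.
  intros H j x Hj. apply Rbar_plus_nonneg_lt in H.
  - now apply (sum_sup_deriv_lt f (hk sigma)).
  - apply sum_sup_deriv_nonneg.
  - apply holder_semi_nonneg.
Qed.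

Lemma hnorm_lt_semi sigma f e : Rbar_lt (hnorm sigma f) (Finite e) ->
  forall x y, x <> y ->
  Rabs (Derive_n f (hk sigma) x - Derive_n f (hk sigma) y) < e * Rpower (Rabs (x - y)) (hb sigma).
Proof.
  intros H x y Hxy. apply Rbar_plus_nonneg_lt in H.
  2: apply sum_sup_deriv_nonneg. 2: apply holder_semi_nonneg.
  assert (Hp : 0 < Rpower (Rabs (x - y)) (hb sigma)) by apply exp_pos.
  apply Rmult_lt_reg_r with (/ Rpower (Rabs (x - y)) (hb sigma)); [now apply Rinv_0_lt_compat|].
  rewrite Rmult_assoc, Rinv_r, Rmult_1_r by lra.
  apply (Lub_Rbar_lt _ _ _ (proj2 H)). exists x, y. auto.
Qed.

Lemma hk_ge (n : nat) sigma : INR n <= sigma -> (n <= hk sigma)%nat.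
Proof.
  intros H. unfold hk. destruct (base_Int_part sigma) as [_ H2].
  rewrite INR_IZR_INZ in H.
  assert (Z.of_nat n < Int_part sigma + 1)%Z; [|lia].
  apply lt_IZR. rewrite plus_IZR. lra.
Qed.

Lemma hb_bounds sigma : 0 <= hb sigma < 1.
Proof. unfold hb. destruct (base_Int_part sigma). lra. Qed.

Lemma Int_part_2_plus alpha : 0 < alpha < 1 -> Int_part (2 + alpha) = 2%Z.
Proof.
  intros Ha. destruct (base_Int_part (2 + alpha)) as [H1 H2].
  assert (Int_part (2 + alpha) < 3)%Z by (apply lt_IZR; lra).
  assert (1 < Int_part (2 + alpha))%Z by (apply lt_IZR; lra). lia.
Qed.

Lemma Rpower_holder_cont (g : R -> R) K beta : 0 < K -> 0 < beta ->
  (forall x y, x <> y -> Rabs (g x - g y) < K * Rpower (Rabs (x - y)) beta) -> cont g.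
Proof.
  intros HK Hb H x. apply continuity_pt_filterlim. intros e He.
  exists (Rpower (e / K) (/ beta)). split; [apply exp_pos|].
  intros y [[_ Hxy] Hd]. simpl in Hd. unfold Rdist in *.
  change (Rabs (g y - g x) < e).
  apply Rlt_trans with (K * Rpower (Rabs (y - x)) beta); [apply H; auto|].
  assert (HeK : 0 < e / K) by (apply Rdiv_lt_0_compat; auto).
  replace e with (K * (e / K)) at 1 by (field; lra).
  apply Rmult_lt_compat_l; auto.
  replace (e / K) with (Rpower (Rpower (e / K) (/ beta)) beta) at 1.
  - apply Rlt_Rpower_l; auto. split; auto. apply Rabs_pos_lt. lra.
  - rewrite Rpower_mult, Rinv_l by lra. now apply Rpower_1.
Qed.

(** Membership gives existence of the derivatives; continuity of the second one is read off the
    finite Hölder seminorm of exponent [alpha > 0]. *)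
Lemma in_h_C2_profile alpha r : 0 < alpha < 1 -> in_h (2 + alpha) r ->
  (forall x, is_derive r x (Derive r x)) /\
  (forall x, is_derive (Derive r) x (Derive_n r 2 x)) /\
  cont (Derive_n r 2) /\ periodic r.
Proof.
  intros Ha [[Hp [Hd Hf]] _].
  assert (Hk : hk (2 + alpha) = 2%nat) by (unfold hk; now rewrite Int_part_2_plus).
  assert (Hb : hb (2 + alpha) = alpha) by (unfold hb; rewrite Int_part_2_plus; auto; lra).
  rewrite Hk in Hd. split; [|split; [|split; [|exact Hp]]].
  - intros x. apply Derive_correct. apply (Hd 1%nat). lia.
  - intros x. apply (Derive_correct (Derive r)). apply (Hd 2%nat). lia.
  - set (K := real (hnorm (2 + alpha) r) + 1).
    assert (H : Rbar_lt (hnorm (2 + alpha) r) (Finite K)).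
    { rewrite <- Hf. unfold K. simpl. lra. }
    apply (Rpower_holder_cont _ K alpha); [|lra|].
    + apply Rle_lt_trans with (Rabs (Derive_n r 0 0)); [apply Rabs_pos|].
      apply (hnorm_lt_sup _ _ _ H). lia.
    + assert (H' := hnorm_lt_semi _ _ _ H). now rewrite Hk, Hb in H'.
Qed.

(** * The perturbation [c + eta cos x] *)

(** Each derivative is a phase shift by [PI / 2], so all orders share the same bounds. Order [0]
    stands apart because it carries [c]. *)
Definition cos_deriv (c eta : R) (n : nat) (x : R) : R :=
  match n with
  | O => c + eta * cos x
  | S _ => eta * cos (x + INR n * (PI / 2))
  end.

Lemma is_derive_cos_deriv c eta n x :
  is_derive (cos_deriv c eta n) x (cos_deriv c eta (S n) x).
Proof.
  destruct n as [|n]; unfold cos_deriv.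
  - auto_derive; auto. replace (INR 1 * (PI / 2)) with (PI / 2) by (simpl; ring).
    rewrite cos_plus, cos_PI2, sin_PI2. ring.
  - rewrite (S_INR (S n)). set (k := INR (S n)).
    replace (x + (k + 1) * (PI / 2)) with (x + k * (PI / 2) + PI / 2) by ring.
    rewrite (cos_plus _ (PI / 2)), cos_PI2, sin_PI2. auto_derive; auto. ring.
Qed.

Lemma Derive_n_cos_deriv c eta f : (forall x, f x = c + eta * cos x) ->
  forall n x, Derive_n f n x = cos_deriv c eta n x.
Proof.
  intros Hf. induction n as [|n IH]; intros x; simpl Derive_n; [apply Hf|].
  rewrite (Derive_ext _ (cos_deriv c eta n)) by exact IH.
  apply is_derive_unique, is_derive_cos_deriv.
Qed.

(** At distance [d <= 1] the Lipschitz bound gives [d <= d^beta]; beyond [1] the oscillation [2] is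
    at most [2 d^beta]. *)
Lemma cos_shift_holder beta x y th : 0 <= beta < 1 -> x <> y ->
  Rabs (cos (x + th) - cos (y + th)) <= 2 * Rpower (Rabs (x - y)) beta.
Proof.
  intros Hb Hxy. assert (Hp : 0 < Rabs (x - y)) by (apply Rabs_pos_lt; lra).
  destruct (Rle_dec (Rabs (x - y)) 1) as [H1|H1].
  - apply Rle_trans with (Rabs (x - y)).
    + destruct (MVT_gen cos (y + th) (x + th) (fun t => - sin t)) as [c [_ E]].
      * intros. auto_derive; auto; ring.
      * intros. apply continuity_pt_filterlim, continuous_cos.
      * rewrite E. replace (x + th - (y + th)) with (x - y) by ring.
        rewrite <- (Rmult_1_l (Rabs (x - y))). apply Rabs_mul_le; [|lra].
        rewrite Rabs_Ropp. apply Rabs_le, SIN_bound.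
    + assert (Rabs (x - y) <= Rpower (Rabs (x - y)) beta).
      { rewrite <- (Rpower_1 (Rabs (x - y))) at 1 by auto. unfold Rpower.
        assert (Hl : ln (Rabs (x - y)) <= 0).
        { rewrite <- ln_1. destruct H1 as [H1|H1]; [left; now apply ln_increasing|rewrite H1; lra]. }
        destruct (Rle_lt_or_eq_dec (1 * ln (Rabs (x - y))) (beta * ln (Rabs (x - y)))) as [L|L].
        - nra.
        - left. now apply exp_increasing.
        - rewrite L. lra. }
      assert (0 < Rpower (Rabs (x - y)) beta) by apply exp_pos. lra.
  - apply Rle_trans with (2 * 1).
    + assert (B1 := COS_bound (x + th)). assert (B2 := COS_bound (y + th)).
      apply Rabs_le. lra.
    + apply Rmult_le_compat_l; [lra|].
      rewrite <- (Rpower_O (Rabs (x - y))) by auto.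
      apply Rle_Rpower; lra.
Qed.

(** The suprema of orders [0] to [hk sigma] contribute [|eta|] each, the Hölder seminorm [2 |eta|].
    Linearity in [eta] is what places the datum in any prescribed ball. *)
Lemma hnorm_cos_le sigma c eta f : (forall x, f x = c + eta * cos x) ->
  Rbar_le (hnorm sigma f) (Finite (Rabs c + (INR (hk sigma) + 3) * Rabs eta)).
Proof.
  intros Hf. assert (HD := Derive_n_cos_deriv c eta f Hf).
  assert (Hcos : forall z, Rabs (eta * cos z) <= Rabs eta).
  { intros z. rewrite <- (Rmult_1_r (Rabs eta)). apply Rabs_mul_le; [lra|].
    apply Rabs_le, COS_bound. }
  assert (HS : forall k, Rbar_le (sum_sup_deriv f k) (Finite (Rabs c + (INR k + 1) * Rabs eta))).
  { induction k as [|k IH].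
    - apply Lub_Rbar_le. intros v [x ->]. rewrite HD. simpl.
      eapply Rle_trans; [apply Rabs_triang|]. specialize (Hcos x). lra.
    - simpl sum_sup_deriv.
      replace (Finite (Rabs c + (INR (S k) + 1) * Rabs eta)) with
        (Rbar_plus (Finite (Rabs c + (INR k + 1) * Rabs eta)) (Finite (Rabs eta))).
      2: { rewrite S_INR. simpl. f_equal. ring. }
      apply Rbar_plus_le_compat; auto.
      apply Lub_Rbar_le. intros v [x ->]. rewrite HD. unfold cos_deriv. apply Hcos. }
  unfold hnorm, holder_norm_kb.
  replace (Finite (Rabs c + (INR (hk sigma) + 3) * Rabs eta)) with
    (Rbar_plus (Finite (Rabs c + (INR (hk sigma) + 1) * Rabs eta)) (Finite (2 * Rabs eta))).
  2: { simpl. f_equal. ring. }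
  apply Rbar_plus_le_compat; auto.
  apply Lub_Rbar_le. intros v [x [y [Hxy ->]]]. rewrite !HD.
  assert (Hp : 0 < Rpower (Rabs (x - y)) (hb sigma)) by apply exp_pos.
  apply Rmult_le_reg_r with (Rpower (Rabs (x - y)) (hb sigma)); auto.
  unfold Rdiv. rewrite Rmult_assoc, Rinv_l, Rmult_1_r by lra.
  assert (E : exists th, cos_deriv c eta (hk sigma) x - cos_deriv c eta (hk sigma) y
     = eta * (cos (x + th) - cos (y + th))).
  { destruct (hk sigma) as [|n]; unfold cos_deriv.
    - exists 0. rewrite !Rplus_0_r. ring.
    - exists (INR (S n) * (PI / 2)). ring. }
  destruct E as [th ->].
  replace (2 * Rabs eta * Rpower (Rabs (x - y)) (hb sigma)) with
    (Rabs eta * (2 * Rpower (Rabs (x - y)) (hb sigma))) by ring.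
  apply Rabs_mul_le; [lra|]. apply cos_shift_holder; auto. apply hb_bounds.
Qed.

Lemma in_h_cos sigma c eta : in_h sigma (fun x => c + eta * cos x).
Proof.
  set (f := fun x => c + eta * cos x).
  assert (HD := Derive_n_cos_deriv c eta f (fun x => eq_refl)).
  assert (Hp : periodic f) by (intros x; unfold f; now rewrite periodic_cos).
  assert (He : forall n x, ex_derive_n f n x).
  { intros [|n] x; simpl; auto. apply (ex_derive_ext (cos_deriv c eta n)).
    - intros t. now rewrite HD.
    - eexists. apply is_derive_cos_deriv. }
  split; [split; [exact Hp|split; [auto|]]|].
  - assert (H1 := hnorm_cos_le sigma c eta f (fun x => eq_refl)).
    assert (H0 : Rbar_le (Finite 0) (hnorm sigma f)).
    { apply Rbar_plus_nonneg; [apply sum_sup_deriv_nonneg|apply holder_semi_nonneg]. }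
    destruct (hnorm sigma f); simpl in *; [reflexivity|tauto|tauto].
  - intros e Hpos. exists f. split; [now split|].
    eapply Rbar_le_lt_trans; [apply (hnorm_cos_le sigma 0 0); intros; ring|].
    rewrite Rabs_R0. simpl. lra.
Qed.

(** * Differentiating integrals along the flow *)

(** Differentiability in time for the sup norm in space, which is enough to differentiate under the
    integral. Continuity of the nearby slices is included because the integral rules require it. *)
Definition unif_derive (F : R -> R -> R) (F' : R -> R) (t : R) : Prop :=
  cont (F t) /\ cont F' /\
  forall e, 0 < e -> exists eta, 0 < eta /\
    forall h, h <> 0 -> Rabs h < eta -> cont (F (t + h)) /\
      forall x, Rabs ((F (t + h) x - F t x) / h - F' x) <= e.

Lemma unif_derive_tint F F' t : unif_derive F F' t ->
  is_derive (fun s => tint (F s)) t (tint F').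
Proof.
  intros [C0 [C' H]]. apply is_derive_Reals. intros e He.
  assert (HP := PI_RGT_0).
  destruct (H (e / (4 * PI))) as [eta [Heta K]]; [apply Rdiv_lt_0_compat; lra|].
  exists (mkposreal eta Heta). simpl. intros h Hh Hlt. destruct (K h Hh Hlt) as [Ch B].
  replace ((tint (F (t + h)) - tint (F t)) / h - tint F') with
    (tint (fun x => / h * (F (t + h) x - F t x) - F' x)).
  - apply Rle_lt_trans with (2 * PI * (e / (4 * PI))).
    + apply tint_abs_le; [cont_tac|]. intros x.
      replace (/ h * (F (t + h) x - F t x)) with ((F (t + h) x - F t x) / h); auto.
      apply Rmult_comm.
    + replace (2 * PI * (e / (4 * PI))) with (e / 2) by (field; lra). lra.
  - rewrite rint_minus, rint_scal, rint_minus by cont_tac. field. auto.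
Qed.

Lemma unif_derive_mult_bounded F F' t w : unif_derive F F' t -> cont w ->
  (forall x, Rabs (w x) <= 1) ->
  unif_derive (fun s x => F s x * w x) (fun x => F' x * w x) t.
Proof.
  intros [C0 [C' H]] Cw Bw. split; [cont_tac|split; [cont_tac|]].
  intros e He. destruct (H e He) as [eta [Heta K]]. exists eta. split; auto.
  intros h Hh Hlt. destruct (K h Hh Hlt) as [Ch B]. split; [cont_tac|].
  intros x. replace (_ - _) with (((F (t + h) x - F t x) / h - F' x) * w x) by (field; auto).
  rewrite <- (Rmult_1_r e). now apply Rabs_mul_le.
Qed.

(** With [d] the difference quotient of [F], the error for the square is [2 F (d - F') + h d^2];
    each summand is made at most [e / 2]. *)
Lemma unif_derive_sq F F' t K : unif_derive F F' t -> 0 < K ->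
  (forall x, Rabs (F t x) <= K) -> (forall x, Rabs (F' x) <= K) ->
  unif_derive (fun s x => F s x ^ 2) (fun x => 2 * (F t x * F' x)) t.
Proof.
  intros [C0 [C' H]] HK B0 B'. split; [cont_tac|split; [cont_tac|]].
  intros e He.
  (* The bound [1] keeps [|d|] below [K + 1], uniformly in [x]. *)
  set (e0 := Rmin 1 (e / (4 * K))).
  assert (H1 : 0 < e / (4 * K)) by (apply Rdiv_lt_0_compat; lra).
  assert (He0 : 0 < e0 /\ e0 <= 1 /\ e0 <= e / (4 * K)).
  { unfold e0. split; [apply Rmin_pos; lra|split; [apply Rmin_l|apply Rmin_r]]. }
  destruct (H e0) as [eta [Heta Hq]]; [apply He0|].
  assert (HK2 : 0 < (K + 1) * (K + 1)) by nra.
  assert (H2 : 0 < e / (2 * ((K + 1) * (K + 1)))) by (apply Rdiv_lt_0_compat; lra).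
  exists (Rmin eta (e / (2 * ((K + 1) * (K + 1))))). split; [now apply Rmin_pos|].
  intros h Hh Hlt. destruct (Hq h Hh) as [Ch B].
  { eapply Rlt_le_trans; [exact Hlt|apply Rmin_l]. }
  split; [cont_tac|]. intros x. specialize (B x).
  set (d := (F (t + h) x - F t x) / h) in *.
  assert (Bd : Rabs d <= K + 1).
  { replace d with (F' x + (d - F' x)) by ring. eapply Rle_trans; [apply Rabs_triang|].
    apply Rplus_le_compat; auto. apply Rle_trans with e0; [auto|apply He0]. }
  replace (F (t + h) x) with (F t x + h * d) by (unfold d; field; auto).
  replace (_ - _) with (2 * (F t x * (d - F' x)) + h * (d * d)) by (field; auto).
  eapply Rle_trans; [apply Rabs_triang|].
  replace e with (2 * (K * (e / (4 * K))) + e / (2 * ((K + 1) * (K + 1))) * ((K + 1) * (K + 1)))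
    by (field; split; nra).
  apply Rplus_le_compat.
  - apply Rabs_mul_le; [rewrite Rabs_pos_eq; lra|]. apply Rabs_mul_le; auto.
    apply Rle_trans with e0; [auto|apply He0].
  - apply Rabs_mul_le; [|now apply Rabs_mul_le].
    left. eapply Rlt_le_trans; [exact Hlt|apply Rmin_r].
Qed.

(** * The cone functional *)

(** By orthogonality this is [|p|^2 - |v - p|^2], positive exactly when the first mode outweighs all
    the others. *)
Definition cone (v : R -> R) : R := 2 * mode1 v - tint (fun x => v x ^ 2).

Lemma cone_le v b : cont v -> 0 <= b -> (forall x, Rabs (v x) <= b) -> cone v <= 2 * PI * b ^ 2.
Proof.
  intros Cv Hb B. assert (HP := PI_RGT_0). assert (H := bessel_mode1 v Cv).
  assert (0 <= tint v ^ 2 / (2 * PI)).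
  { apply Rmult_le_pos; [apply pow2_ge_0|]. left; apply Rinv_0_lt_compat; lra. }
  assert (HN : tint (fun x => v x ^ 2) <= b ^ 2 * (PI - - PI)).
  { rewrite <- rint_const. apply tint_le; try cont_tac.
    intros x. rewrite <- (pow2_abs (v x)). apply pow_incr. split; [apply Rabs_pos|apply B]. }
  unfold cone. lra.
Qed.

(** Closeness in sup norm suffices, so the sign survives convergence in [h^alpha]. In units of
    [eta^2 PI], [2 |p|^2] is at least [2 * 49 / 64], while [|v|^2] is at most
    [1 + 1 / 4 + 1 / 128]. *)
Lemma cone_near_cos_pos v eta : 0 < eta -> cont v ->
  (forall x, Rabs (v x - eta * cos x) <= eta / 16) -> 0 < cone v.
Proof.
  intros He Cv B. assert (HP := PI_RGT_0).
  set (z := fun x => v x - eta * cos x).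
  assert (Cz : cont z) by (unfold z; cont_tac).
  assert (Bc : Rabs (tint (fun x => z x * cos x)) <= 2 * PI * (eta / 16)).
  { apply tint_abs_le; [cont_tac|]. intros x. rewrite <- (Rmult_1_r (eta / 16)).
    apply Rabs_mul_le; [apply B|apply Rabs_le, COS_bound]. }
  assert (Bz : tint (fun x => z x ^ 2) <= (eta / 16) ^ 2 * (PI - - PI)).
  { rewrite <- rint_const. apply tint_le; try cont_tac.
    intros x. rewrite <- (pow2_abs (z x)). apply pow_incr. split; [apply Rabs_pos|apply B]. }
  assert (E1 : tint (fun x => v x * cos x) = eta * PI + tint (fun x => z x * cos x)).
  { rewrite (rint_ext _ (fun x => eta * (cos x * cos x) + z x * cos x)) by (intros; unfold z; ring).
    rewrite rint_plus, rint_scal, tint_cos2 by cont_tac. ring. }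
  assert (E2 : tint (fun x => v x ^ 2)
    = eta ^ 2 * PI + 2 * eta * tint (fun x => z x * cos x) + tint (fun x => z x ^ 2)).
  { rewrite (rint_ext _ (fun x => eta ^ 2 * (cos x * cos x) + (2 * eta) * (z x * cos x) + z x ^ 2))
      by (intros; unfold z; ring).
    rewrite !rint_plus, !rint_scal, tint_cos2 by cont_tac. ring. }
  unfold cone, mode1. rewrite E1, E2.
  set (J := tint (fun x => z x * cos x)) in *. set (I2 := tint (fun x => v x * sin x)).
  apply Rabs_le_between in Bc.
  assert (0 <= I2 ^ 2) by apply pow2_ge_0.
  assert (HI : (eta * PI * (7 / 8)) ^ 2 <= (eta * PI + J) ^ 2).
  { apply pow_incr. assert (0 < eta * PI) by nra. lra. }
  assert (HM : 2 * (49 / 64) * eta ^ 2 * PI <= 2 * (((eta * PI + J) ^ 2 + I2 ^ 2) / PI)).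
  { apply Rmult_le_reg_r with PI; auto.
    replace (2 * (((eta * PI + J) ^ 2 + I2 ^ 2) / PI) * PI) with (2 * ((eta * PI + J) ^ 2 + I2 ^ 2))
      by (field; lra).
    nra. }
  assert (HJ : 2 * eta * J <= 2 * eta * (2 * PI * (eta / 16))) by (apply Rmult_le_compat_l; lra).
  assert (0 < eta ^ 2 * PI) by (apply Rmult_lt_0_compat; auto; apply pow_lt; auto).
  nra.
Qed.

(** The [L^2] gradient of the cone at [v] is [2 (2 p - v)], which is the origin of the
    multiplier. *)
Lemma cone_derive F F' t K : unif_derive F F' t -> 0 < K ->
  (forall x, Rabs (F t x) <= K) -> (forall x, Rabs (F' x) <= K) ->
  is_derive (fun s => cone (F s)) t
    (2 * tint (fun x => F' x * (2 * (tint (fun x => F t x * cos x) / PI * cos x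
                                   + tint (fun x => F t x * sin x) / PI * sin x) - F t x))).
Proof.
  intros HU HK B0 B'. assert (HP := PI_RGT_0).
  assert (D1 : is_derive (fun s => tint (fun x => F s x * cos x)) t (tint (fun x => F' x * cos x))).
  { apply (unif_derive_tint (fun s x => F s x * cos x)), unif_derive_mult_bounded; auto; [cont_tac|].
    intros x. apply Rabs_le, COS_bound. }
  assert (D2 : is_derive (fun s => tint (fun x => F s x * sin x)) t (tint (fun x => F' x * sin x))).
  { apply (unif_derive_tint (fun s x => F s x * sin x)), unif_derive_mult_bounded; auto; [cont_tac|].
    intros x. apply Rabs_le, SIN_bound. }
  assert (D3 := unif_derive_tint _ _ _ (unif_derive_sq F F' t K HU HK B0 B')).
  destruct HU as [C0 [C' _]].
  set (I1 := tint (fun x => F t x * cos x)) in *. set (I2 := tint (fun x => F t x * sin x)) in *.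
  rewrite (rint_ext _ (fun x => (2 * I1 / PI) * (F' x * cos x) + (2 * I2 / PI) * (F' x * sin x)
    + (-1) * (F t x * F' x) + 0 * F t x)) by (intros; field; lra).
  rewrite tint_lin4 by cont_tac. rewrite rint_scal in D3 by cont_tac.
  unfold cone, mode1.
  set (f1 := fun s => tint (fun x => F s x * cos x)) in *.
  set (f2 := fun s => tint (fun x => F s x * sin x)) in *.
  set (f3 := fun s => tint (fun x => F s x ^ 2)) in *.
  change (is_derive (fun s => 2 * ((f1 s ^ 2 + f2 s ^ 2) / PI) - f3 s) t
    (2 * (2 * I1 / PI * tint (fun x => F' x * cos x) + 2 * I2 / PI * tint (fun x => F' x * sin x)
      + -1 * tint (fun x => F t x * F' x) + 0 * tint (F t)))).
  change (is_derive f1 t (tint (fun x => F' x * cos x))) in D1.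
  change (is_derive f2 t (tint (fun x => F' x * sin x))) in D2.
  change (is_derive f3 t (2 * tint (fun x => F t x * F' x))) in D3.
  change I1 with (f1 t). change I2 with (f2 t). clearbody f1 f2 f3.
  set (a1 := tint (fun x => F' x * cos x)) in *. set (a2 := tint (fun x => F' x * sin x)) in *.
  set (a3 := tint (fun x => F t x * F' x)) in *. set (a4 := tint (F t)). clearbody a1 a2 a3 a4.
  auto_derive.
  - repeat split; [now exists a1|now exists a2|now exists (2 * a3)].
  - assert (X1 : Derive (fun s => f1 s) t = a1) by now apply is_derive_unique.
    assert (X2 : Derive (fun s => f2 s) t = a2) by now apply is_derive_unique.
    assert (X3 : Derive (fun s => f3 s) t = 2 * a3) by now apply is_derive_unique.
    rewrite X1, X2, X3. field. lra.
Qed.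

(** The product [g t * exp (- k t)] is nondecreasing, so a positive [g t0] would force exponential
    growth past [C]. *)
Lemma exponential_growth_unbounded (g g' : R -> R) k C t0 : 0 < k ->
  (forall t, t0 <= t -> is_derive g t (g' t)) ->
  (forall t, t0 <= t -> k * g t <= g' t) ->
  (forall t, t0 <= t -> g t <= C) -> g t0 <= 0.
Proof.
  intros Hk Hd Hg HC. destruct (Rle_lt_dec (g t0) 0) as [|Hp]; auto. exfalso.
  assert (HC0 := HC t0 (Rle_refl _)).
  (* Already the bound [1 + x < exp x] gives [g T > g t0 + C] at this time. *)
  set (T := t0 + C / (k * g t0)).
  assert (Hkg : 0 < k * g t0) by nra.
  assert (HT : t0 < T). { unfold T. assert (0 < C / (k * g t0)) by (apply Rdiv_lt_0_compat; lra). lra. }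
  assert (HD : forall t, t0 <= t ->
    is_derive (fun t => g t * exp (- k * t)) t ((g' t - k * g t) * exp (- k * t))).
  { intros t Ht. assert (H := Hd t Ht). auto_derive.
    - repeat split. now exists (g' t).
    - assert (X : Derive (fun t => g t) t = g' t) by now apply is_derive_unique.
      rewrite X. ring. }
  destruct (MVT_gen (fun t => g t * exp (- k * t)) t0 T (fun t => (g' t - k * g t) * exp (- k * t)))
    as [c [Hc E]].
  - rewrite Rmin_left, Rmax_right by lra. intros x Hx. apply HD. lra.
  - rewrite Rmin_left, Rmax_right by lra. intros x Hx. apply continuity_pt_filterlim.
    apply (ex_derive_continuous (V := R_NormedModule) (fun t => g t * exp (- k * t))).
    eexists. apply HD. lra.
  - rewrite Rmin_left, Rmax_right in Hc by lra.
    assert (H1 : 0 <= (g' c - k * g c) * exp (- k * c) * (T - t0)).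
    { apply Rmult_le_pos; [|lra]. apply Rmult_le_pos; [|left; apply exp_pos].
      specialize (Hg c). lra. }
    assert (H2 : g t0 * exp (k * (T - t0)) <= g T).
    { apply Rmult_le_reg_r with (exp (- k * T)); [apply exp_pos|].
      rewrite Rmult_assoc, <- exp_plus.
      replace (k * (T - t0) + - k * T) with (- k * t0) by ring. lra. }
    assert (H3 : 1 + k * (T - t0) < exp (k * (T - t0))).
    { apply exp_ineq1. apply Rgt_not_eq. nra. }
    assert (H4 : g t0 * (1 + k * (T - t0)) = g t0 + C).
    { unfold T. field. lra. }
    specialize (HC T). nra.
Qed.

(** * Instability *)

Lemma in_h_bounded sigma f : in_h sigma f -> exists K, 0 < K /\ forall x, Rabs (f x) <= K.
Proof.
  intros [[_ [_ Hf]] _]. exists (real (hnorm sigma f) + 1).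
  assert (H : Rbar_lt (hnorm sigma f) (Finite (real (hnorm sigma f) + 1))).
  { rewrite <- Hf at 1. simpl. lra. }
  assert (B := fun x => hnorm_lt_sup _ _ _ H 0 x (Nat.le_0_l _)). simpl in B.
  split.
  - apply Rle_lt_trans with (Rabs (f 0)); [apply Rabs_pos|apply B].
  - intros x. left. apply B.
Qed.

Lemma Cw_in_h mu sigma u t : Cw mu sigma u -> 0 < t -> in_h sigma (u t).
Proof.
  intros [[_ [H _]]|[_ H]] Ht; apply H; [exact Ht|left; exact Ht].
Qed.

Lemma solution_unif_derive mu alpha r0 r rs t :
  0 < alpha < 1 -> global_solution mu alpha r0 r -> 0 < t ->
  unif_derive (fun s x => r s x - rs) (Gop (r t)) t.
Proof.
  intros Ha [_ [_ [HC [Hpos [r' [[Hd [_ _]] HG]]]]]] Ht.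
  assert (Cr : forall s, 0 < s -> cont (r s)).
  { intros s Hs. destruct (in_h_C2_profile alpha (r s) Ha (Cw_in_h _ _ _ _ HC Hs)) as [H1 _].
    exact (cont_derive _ _ H1). }
  assert (CG : cont (Gop (r t))).
  { destruct (in_h_C2_profile alpha (r t) Ha (Cw_in_h _ _ _ _ HC Ht)) as [H1 [H2 [H3 H4]]].
    apply (cont_Gop (r t) (Derive (r t)) (Derive_n (r t) 2)); auto. }
  split; [|split; [exact CG|]].
  { assert (C := Cr t Ht). cont_tac. }
  (* Both readings of the time domain, [mu < 1] and [mu = 1], reduce to positive times. *)
  assert (Hd' : has_deriv_on pos_half alpha r r').
  { destruct (Rlt_dec mu 1); [exact Hd|]. intros s Hs e He.
    destruct (Hd s (Rlt_le _ _ Hs) e He) as [eta [Heta K]]. exists eta. split; auto.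
    intros h Hh Hlt Hp. apply K; auto. left; exact Hp. }
  intros e He. destruct (Hd' t Ht e He) as [eta [Heta K]].
  (* The cap [t] keeps [t + h] positive, where the slices are known to be regular. *)
  exists (Rmin eta t). split; [now apply Rmin_pos|]. intros h Hh Hlt.
  assert (Hlt1 := Rlt_le_trans _ _ _ Hlt (Rmin_l _ _)).
  assert (Hlt2 := Rlt_le_trans _ _ _ Hlt (Rmin_r _ _)).
  assert (Hth : 0 < t + h) by (apply Rabs_lt_between in Hlt2; lra).
  split.
  { assert (C := Cr _ Hth). cont_tac. }
  intros x. rewrite <- HG by auto.
  replace (r (t + h) x - rs - (r t x - rs)) with (r (t + h) x - r t x) by ring.
  left. exact (hnorm_lt_sup _ _ _ (K h Hh Hlt1 Hth) 0 x (Nat.le_0_l _)).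
Qed.

(** The tolerance [eps] is tied to [rs] alone, while [eta > 0] is arbitrary: however small the
    perturbation along [cos], its solution leaves the [eps]-ball. *)
Lemma no_small_unstable_solution mu alpha rs e eps eta r :
  0 < alpha < 1 -> 0 < rs < 1 -> 1 < 2 * mu + alpha ->
  0 < e -> e <= 1 / 8 -> e <= (/ rs ^ 2 - 1) / 8 -> eps = e * rs ^ 3 / 20 -> 0 < eta ->
  global_solution mu alpha (fun x => rs + eta * cos x) r ->
  (forall t, 0 <= t ->
    Rbar_lt (hnorm (2 * mu + alpha) (diff_fun (r t) (fun _ => rs))) (Finite eps)) ->
  False.
Proof.
  intros Ha Hrs Hsig He0 He1 He2 Heps Heta HS HB.
  assert (Hr3 : 0 < rs ^ 3) by (apply pow_lt; lra).
  assert (Heps' : 0 < eps <= rs / 4).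
  { rewrite Heps. split.
    - apply Rmult_lt_0_compat; [now apply Rmult_lt_0_compat|lra].
    - assert (rs ^ 3 <= rs) by (simpl; nra). nra. }
  assert (HC2 : forall t, 0 < t -> (forall x, is_derive (r t) x (Derive (r t) x)) /\
     (forall x, is_derive (Derive (r t)) x (Derive_n (r t) 2 x)) /\
     cont (Derive_n (r t) 2) /\ periodic (r t)).
  { intros t Ht. apply (in_h_C2_profile alpha); auto.
    destruct HS as [_ [_ [HC _]]]. exact (Cw_in_h _ _ _ _ HC Ht). }
  assert (Bv : forall t x, 0 < t -> Rabs (r t x - rs) <= eps).
  { intros t x Ht. left. exact (hnorm_lt_sup _ _ _ (HB t (Rlt_le _ _ Ht)) 0 x (Nat.le_0_l _)). }
  assert (Bv1 : forall t x, 0 < t -> Rabs (Derive (r t) x) <= eps).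
  { intros t x Ht. left.
    (* The norm sees the first derivative because [2 * mu + alpha > 1]. *)
    assert (H1 : (1 <= hk (2 * mu + alpha))%nat) by (apply hk_ge; simpl; lra).
    assert (H := hnorm_lt_sup _ _ _ (HB t (Rlt_le _ _ Ht)) 1 x H1). simpl in H.
    replace (Derive (r t) x) with (Derive (diff_fun (r t) (fun _ => rs)) x); auto.
    apply is_derive_unique. unfold diff_fun. destruct (HC2 t Ht) as [H2 _].
    apply is_derive_minus_const, H2. }
  set (v := fun t x => r t x - rs).
  assert (Cv : forall t, 0 < t -> cont (v t)).
  { intros t Ht. unfold v. assert (C := cont_derive _ _ (proj1 (HC2 t Ht))). cont_tac. }
  (* The equation holds only for [t > 0], and for [mu < 1] the derivative may be singular at [0].
     The growth argument therefore starts at a small positive time. *)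
  assert (Ht0 : exists t0, 0 < t0 /\ 0 < cone (v t0)).
  { destruct HS as [_ [Hlim _]]. destruct (Hlim (eta / 16)) as [d [Hd K]]; [lra|].
    exists (d / 2). split; [lra|]. apply (cone_near_cos_pos _ eta Heta); [apply Cv; lra|].
    intros x. left. assert (Hd2 : 0 < d / 2 < d) by lra.
    assert (H := hnorm_lt_sup _ _ _ (K _ Hd2) 0 x (Nat.le_0_l _)). simpl in H. unfold diff_fun in H.
    unfold v. replace (r (d / 2) x - rs - eta * cos x) with (r (d / 2) x - (rs + eta * cos x)) by ring.
    exact H. }
  destruct Ht0 as [t0 [Ht0 Hc0]].
  set (k := / rs ^ 2 - 1 - 3 * e).
  assert (Hle : cone (v t0) <= 0); [|lra].
  apply (exponential_growth_unbounded (fun t => cone (v t))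
    (fun t => 2 * tint (fun x => Gop (r t) x * (2 * (tint (fun x => v t x * cos x) / PI * cos x
        + tint (fun x => v t x * sin x) / PI * sin x) - v t x))) (2 * k) (2 * PI * eps ^ 2)).
  - unfold k. lra.
  - intros t Ht. assert (Htp : 0 < t) by lra.
    (* This bound may depend on [t]: it serves only to differentiate the cone at that instant, and
       the growth rate does not involve it. *)
    assert (HK : exists K, 0 < K /\ forall x, Rabs (Gop (r t) x) <= K).
    { destruct HS as [_ [_ [_ [_ [r' [[_ [_ HC']] HG]]]]]].
      destruct (in_h_bounded _ _ (Cw_in_h _ _ _ _ HC' Htp)) as [K [HK BK]].
      exists K. split; auto. intros x. rewrite <- HG; auto. }
    destruct HK as [K [HK BK]].
    apply (cone_derive v (Gop (r t)) t (Rmax K eps)).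
    + exact (solution_unif_derive _ _ _ _ rs t Ha HS Htp).
    + apply Rlt_le_trans with K; auto. apply Rmax_l.
    + intros x. apply Rle_trans with eps; [now apply Bv|apply Rmax_r].
    + intros x. apply Rle_trans with K; [auto|apply Rmax_l].
  - intros t Ht. assert (Htp : 0 < t) by lra. rewrite Rmult_assoc. apply Rmult_le_compat_l; [lra|].
    destruct (HC2 t Htp) as [H1 [H2 [H3 H4]]].
    apply (cone_growth (r t) (Derive (r t)) (Derive_n (r t) 2)) with (eps := eps); auto.
    + intros x. destruct HS as [_ [_ [_ [Hpos _]]]]. auto.
    + rewrite Heps. field. lra.
  - intros t Ht. apply cone_le; [apply Cv; lra|lra|]. intros x. apply Bv. lra.
Qed.

Theorem theorem5p4 (alpha rstar mu : R)
  (Halpha : 0 < alpha < 1) (Hr : 0 < rstar < 1)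
  (Hmu : 1 / 2 <= mu <= 1)
  (Hnotint : forall n : Z, 2 * mu + alpha <> IZR n) :
  ~ (forall eps, 0 < eps -> exists delta, 0 < delta /\
       forall r0 : R -> R, in_h (2 * mu + alpha) r0 ->
         Rbar_lt (hnorm (2 * mu + alpha) (diff_fun r0 (fun _ => rstar))) (Finite delta) ->
         exists r : R -> R -> R, global_solution mu alpha r0 r /\
           forall t, 0 <= t ->
             Rbar_lt (hnorm (2 * mu + alpha) (diff_fun (r t) (fun _ => rstar)))
                     (Finite eps)).
Proof.
  intros H.
  assert (Hq : 1 < / rstar ^ 2).
  { rewrite <- Rinv_1. apply Rinv_lt_contravar; nra. }
  (* The largest error level that the growth inequality admits; the tolerance below solves
     [e = 20 eps / rstar^3]. *)
  set (e := Rmin (1 / 8) ((/ rstar ^ 2 - 1) / 8)).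
  assert (He : 0 < e) by (apply Rmin_pos; lra).
  destruct (H (e * rstar ^ 3 / 20)) as [delta [Hd K]].
  { apply Rmult_lt_0_compat; [apply Rmult_lt_0_compat; [auto|apply pow_lt; lra]|lra]. }
  set (C := INR (hk (2 * mu + alpha)) + 3).
  assert (HC : 0 < C) by (unfold C; generalize (pos_INR (hk (2 * mu + alpha))); lra).
  (* Makes the norm of the perturbation at most [delta / 2]. *)
  set (eta := delta / (2 * C)).
  assert (Heta : 0 < eta) by (apply Rdiv_lt_0_compat; lra).
  destruct (K (fun x => rstar + eta * cos x)) as [r [HS HB]].
  - apply in_h_cos.
  - eapply Rbar_le_lt_trans; [apply (hnorm_cos_le _ 0 eta); intros; unfold diff_fun; ring|].
    rewrite Rabs_R0, (Rabs_pos_eq eta) by lra. fold C. simpl.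
    replace (0 + C * eta) with (delta / 2) by (unfold eta; field; lra). lra.
  - apply (no_small_unstable_solution mu alpha rstar e (e * rstar ^ 3 / 20) eta r); auto; try lra.
    + apply Rmin_l.
    + apply Rmin_r.
Qed.
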